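(* (Hexagon Equation) Let $\mathcal{A}$ be an arbitrary unital associative complex algebra, and let $A,B,C\in\mathcal{A}$ be three elements such that $\Lambda:=A+B+C$ commutes with each of $A$, $B$ and $C$. Then the Drinfel'd associator $\Phi$ satisfies, in $\mathcal{A}[[\lambda]]$, $$ e^{\lambda\pi\mathbf{i}\Lambda}=e^{\lambda\pi\mathbf{i}A}\,\Phi(C,A)\,e^{\lambda\pi\mathbf{i}C}\,\Phi(B,C)\,e^{\lambda\pi\mathbf{i}B}\,\Phi(A,B). $$
   Context: $\mathcal{A}[[\lambda]]$ is the algebra of formal power series in the formal parameter $\lambda$ with coefficients in $\mathcal{A}$; for $X\in\mathcal{A}$ and $t\in\mathbb{C}$, $e^{\lambda tX}=\sum_{r\ge0}\frac{\lambda^r t^r}{r!}X^r$; $\mathbf{i}$ is the imaginary unit. Drinfel'd associator: for $X,Y\in\mathcal{A}$ and $\delta,\epsilon\in\,]0,1/4]$ let $W_{\delta,\epsilon}(X,Y)\in\mathcal{A}[[\lambda]]$ be the parallel transport from $\delta$ to $1-\epsilon$ of the formal connection $\left(\frac1xX+\frac1{x-1}Y\right)\mathsf{d}x$ on $]0,1[$, i.e. the value at $x=1-\epsilon$ of the unique solution of $\frac{\mathsf{d}W}{\mathsf{d}x}=\lambda\left(\frac1xX+\frac{1}{x-1}Y\right)W$ with $W(\delta)=1$. Explicitly, with $X_0=X$, $X_1=Y$, $$W_{\delta,\epsilon}(X,Y)=1+\sum_{r\ge1}\lambda^r\sum_{i_1,\ldots,i_r\in\{0,1\}}\left(\int_\delta^{1-\epsilon}\frac{\mathsf{d}u_1}{u_1-i_1}\int_\delta^{u_1}\frac{\mathsf{d}u_2}{u_2-i_2}\cdots\int_\delta^{u_{r-1}}\frac{\mathsf{d}u_r}{u_r-i_r}\right)X_{i_1}\cdots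 X_{i_r}.$$ Then $$\Phi(X,Y):=\lim_{(\delta,\epsilon)\to(0,0)}e^{-\lambda\ln(\epsilon)Y}\,W_{\delta,\epsilon}(X,Y)\,e^{\lambda\ln(\delta)X}\in\mathcal{A}[[\lambda]],$$ where the limit (which exists) is taken separately for each power of $\lambda$; each coefficient takes values in a finite-dimensional subspace of $\mathcal{A}$, and the limit is with respect to any norm on $\mathcal{A}$ (the choice does not matter). *)

(* Defs.v *)
From mathcomp Require Import all_boot all_order all_algebra.
From mathcomp Require Import all_classical all_reals all_analysis.
From mathcomp Require Import complex.
Import Order.TTheory GRing.Theory Num.Theory.
Import numFieldNormedType.Exports.

Set Implicit Arguments.
Unset Strict Implicit.
Unset Printing Implicit Defensive.

Local Open Scope classical_set_scope.
Local Open Scope ring_scope.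
Local Open Scope complex_scope.

(* A[[lambda]]: a series is its sequence of coefficients. *)
Definition fps (A : Type) : Type := nat -> A.

Definition fps_mul (A : pzRingType) (f g : fps A) : fps A :=
  fun n => \sum_(k < n.+1) f k * g (n - k)%N.

Notation "f *_fps g" := (fps_mul f g)
  (at level 40, left associativity) : ring_scope.

(* fps_exp t X is exp(lambda t X). *)
Definition fps_exp (K : fieldType) (A : algType K) (t : K) (X : A)
    : fps A :=
  fun r => (t ^+ r / r`!%:R) *: X ^+ r.

(* For s = [:: i_1; ...; i_r], with true standing for 1 and false for 0:
   \int_d^x du_1/(u_1 - i_1) \int_d^(u_1) du_2/(u_2 - i_2) ...
     \int_d^(u_(r-1)) du_r/(u_r - i_r). *)
Fixpoint iterated_int (R : realType) (d : R) (s : seq bool) (x : R) : R :=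
  if s is i :: s' then
    \int[@lebesgue_measure R]_(u in `[d, x])
      ((u - i%:R)^-1 * iterated_int d s' u)
  else 1.

(* Parallel transport from d to 1 - e of the formal connection
   (X / x + Y / (x - 1)) dx; the coefficient of lambda^0 is 1, because the
   only 0-tuple contributes the empty integral times the empty product. *)
Definition transport (R : realType) (A : algType R[i])
    (X Y : A) (d e : R) : fps A :=
  fun r => \sum_(s : r.-tuple bool)
    (iterated_int d s (1 - e))%:C *: \prod_(i <- s) (if i then Y else X).

Definition is_norm (R : realType) (V : lmodType R[i]) (N : V -> R) : Prop :=
  [/\ forall x, 0 <= N x,
      forall x, N x = 0 -> x = 0,
      forall x y, N (x + y) <= N x + N y
    & forall (a : R[i]) x, (N (a *: x))%:C = `|a| * (N x)%:C].

(* The filter (d, e) --> (0, 0) with d, e in ]0, 1/4]. *)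
Definition reg_filter (R : realType) : set_system (R * R)%type :=
  within [set p : R * R | 0 < p.1 <= 4^-1 /\ 0 < p.2 <= 4^-1]
    (nbhs ((0, 0) : R * R)).

(* No norm on V is fixed. The functions considered here take values in a
   finite-dimensional subspace of V, on which all norms are equivalent, so
   the choice of the norm does not matter. Norms exist on every V. *)
Definition is_reg_lim (R : realType) (V : lmodType R[i])
    (f : R * R -> V) (L : V) : Prop :=
  forall N : V -> R, is_norm N ->
    N (f p - L) @[p --> @reg_filter R] --> (0 : R).

(* The limit is taken separately for each power of lambda; xget selects it
   (0 would be returned if it did not exist). *)
Definition drinfeld_associator (R : realType) (A : algType R[i])
    (X Y : A) : fps A :=
  fun n => xget 0 [set L | is_reg_lim
    (fun p : R * R =>
       (fps_exp (- ln p.2)%:C Y *_fps transport X Y p.1 p.2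
          *_fps fps_exp (ln p.1)%:C X) n) L].

(* Main.v *)
From HB Require Import structures.
Require Import Defs.
From mathcomp Require Import all_boot all_order all_algebra.
From mathcomp Require Import all_classical all_reals all_analysis.
From mathcomp Require Import complex ring lra.
Import Order.TTheory GRing.Theory Num.Theory.
Import numFieldNormedType.Exports.

(** The connection X dx / x + Y dx / (x - 1) has the regular singular points 0, 1
    and infinity, which a homography moves to the cube roots of unity 1, k^2 and
    k^4, where k = exp(- i pi / 3). When X + Y + Z is central it becomes, up to a
    central term,
      X dw / (w - 1) + Y dw / (w - k^2) + Z dw / (w - k^4),
    where the three residues play symmetric roles.

    Near each root zeta there is a canonical solution h(t) t^X, where X is the
    residue at zeta, t = 1 - w / zeta, and h is a power series with h(0) = 1
    (exists_local_sol). It converges as long as |t| is less than the distance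
    sqrt 3 to the other two roots. So the three power series can be compared at
    w = 0, where t = 1 for all of them and no logarithm occurs. The quotients of
    their values there, taken around the triangle, multiply to 1 for trivial
    reasons; no homotopy of paths is needed.

    It remains to express the associator by such a quotient K. On ]0, 1[ the
    canonical solutions at 0 and at 1 differ by the constant Phi(X, Y)
    (drinfeld_associatorE); they are compared at x = 1/2. This point corresponds to
    the midpoint w = k of the arc from 1 to k^2. From w = 0 to w = k the two
    solutions on the disk are continued along a segment (transition), and the one
    at the root 1 is identified with the one at x = 0 by the homography
    (comparison). Following the logarithms gives
      Phi(X, Y) = exp(theta' Y) K exp(- theta X) exp(i pi (X + Y + Z) / 3)
    in A[[lambda]], where theta - theta' = i pi (associator_transition). In the
    product of the hexagon, the exponentials between two quotients K cancel, the
    quotients multiply to 1, and the central factors give the left-hand side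
    (hexagon_equation).

    Since A has no topology, analysis is done on scalars: each coefficient of each
    series is a finite sum of scalar functions times fixed vectors (frderiv), and
    differential equations are solved, and shown to have unique solutions, by
    induction on the power of lambda (fpsderiv_unique). The limit in the definition
    of the associator is unique because A has at least one norm (exists_norm). *)

Set Implicit Arguments.
Unset Strict Implicit.
Unset Printing Implicit Defensive.
Local Open Scope classical_set_scope.
Local Open Scope ring_scope.
Local Open Scope complex_scope.

(** * Complex numbers *)

Section ReIm.
Variable R : realType.
Implicit Types z w : R[i].
Lemma cReD z w : complex.Re (z + w) = complex.Re z + complex.Re w.
Proof. by case: z w => a b [c d]. Qed.
Lemma cImD z w : complex.Im (z + w) = complex.Im z + complex.Im w.
Proof. by case: z w => a b [c d]. Qed.
Lemma cReM z w : complex.Re (z * w) =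
  complex.Re z * complex.Re w - complex.Im z * complex.Im w.
Proof. by case: z w => a b [c d]. Qed.
Lemma cImM z w : complex.Im (z * w) =
  complex.Re z * complex.Im w + complex.Im z * complex.Re w.
Proof. by case: z w => a b [c d]. Qed.
Lemma complex_eqP z w :
  complex.Re z = complex.Re w -> complex.Im z = complex.Im w -> z = w.
Proof. by case: z w => a b [c d] /= -> ->. Qed.
End ReIm.

Section ComplexAbs.
Variable R : realType.
Implicit Types (z w : R[i]) (x : R).

(** The norm of R[i] takes its values in R[i]; estimates need it in R. *)
Definition cabs z : R := ComplexField.Normc.normc z.
Arguments cabs : simpl never.

Lemma cabsE z : `|z| = (cabs z)%:C.
Proof. by rewrite normc_def; case: z. Qed.

Lemma cabs_ge0 z : 0 <= cabs z.
Proof. by rewrite -lecR -cabsE normr_ge0. Qed.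

Lemma cabsM z w : cabs (z * w) = cabs z * cabs w.
Proof. exact: ComplexField.Normc.normcM. Qed.

Lemma ler_cabsD z w : cabs (z + w) <= cabs z + cabs w.
Proof. by rewrite -lecR rmorphD/= -!cabsE ler_normD. Qed.

Lemma cabsN z : cabs (- z) = cabs z.
Proof. by apply: complexI; rewrite -!cabsE normrN. Qed.

Lemma cabs0 : cabs 0 = 0.
Proof. by apply: complexI; rewrite -!cabsE normr0. Qed.

Lemma cabs_eq0 z : (cabs z == 0) = (z == 0).
Proof.
by apply/eqP/eqP => [|->]; [exact: ComplexField.Normc.eq0_normc|exact: cabs0].
Qed.

Lemma cabsV z : cabs z^-1 = (cabs z)^-1.
Proof. exact: ComplexField.Normc.normcV. Qed.

Lemma cabsX z n : cabs (z ^+ n) = cabs z ^+ n.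
Proof. by apply: complexI; rewrite rmorphXn/= -!cabsE normrX. Qed.

Lemma cabsC x : cabs x%:C = `|x|.
Proof. by rewrite /cabs /= expr0n addr0 sqrtr_sqr. Qed.

Lemma cabs_nat n : cabs n%:R = n%:R.
Proof. by rewrite -(rmorph_nat (@real_complex_def R (Phant R))) cabsC ger0_norm. Qed.

Lemma Re_le_cabs z : `|complex.Re z| <= cabs z.
Proof. by rewrite -lecR -cabsE normc_ge_Re. Qed.

Lemma Im_le_cabs z : `|complex.Im z| <= cabs z.
Proof.
by case: z => a b; rewrite /cabs/= -sqrtr_sqr ler_wsqrtr // lerDr sqr_ge0.
Qed.

Lemma sqr_cabs z : cabs z ^+ 2 = complex.Re z ^+ 2 + complex.Im z ^+ 2.
Proof. by case: z => a b; rewrite /cabs/= sqr_sqrtr// addr_ge0 ?sqr_ge0. Qed.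

Lemma ler_cabs_ReIm z : cabs z <= `|complex.Re z| + `|complex.Im z|.
Proof.
rewrite -(@ler_pXn2r _ 2) ?nnegrE ?addr_ge0 ?cabs_ge0//.
by rewrite sqr_cabs sqrrD !real_normK ?num_real// addrAC lerDl mulrn_wge0// mulr_ge0.
Qed.

Lemma complexReIm z : z = (complex.Re z)%:C + 'i * (complex.Im z)%:C.
Proof. by case: z => a b; rewrite [LHS]complexE. Qed.

End ComplexAbs.
Arguments cabs {R} z : simpl never.

(** * Every complex vector space has a norm *)

Section NormExists.
Variables (R : realType) (V : lmodType R[i]).
Implicit Types (G : set (V * R)) (x y v : V) (r s : R).

Let pnorm : set (set (V * R)) := [set G |
  [/\ forall x r s, G (x, r) -> G (x, s) -> r = s,
      forall x r, G (x, r) -> 0 <= r /\ (r = 0 -> x = 0),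
      forall x y r s, G (x, r) -> G (y, s) ->
        exists t, G (x + y, t) /\ t <= r + s
    & forall (a : R[i]) x r, G (x, r) -> G (a *: x, cabs a * r)]].

Let pnorm_chain (F : set (set (V * R))) :
  F `<=` pnorm -> total_on F subset -> pnorm (\bigcup_(G in F) G).
Proof.
move=> FP tot.
have two p q : (\bigcup_(G in F) G) p -> (\bigcup_(G in F) G) q ->
    exists2 G, F G & G p /\ G q.
  move=> [G FG Gp] [H FH Hq]; have [GH|HG] := tot _ _ FG FH.
    by exists H => //; split=> //; exact: GH.
  by exists G => //; split=> //; exact: HG.
split.
- move=> x r s /two /[apply] -[G /FP [P1 _ _ _] [Gr Gs]]; exact: (P1 x).
- move=> x r [G /FP [_ P2 _ _] Gr]; exact: (P2 x).
- move=> x y r s /two /[apply] -[G FG [Gr Gs]]; have [_ _ P3 _] := FP _ FG.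
  by have [t [Gt le]] := P3 _ _ _ _ Gr Gs; exists t; split=> //; exists G.
- by move=> a x r [G FG Gr]; exists G => //; have [_ _ _ P4] := FP _ FG; exact: P4.
Qed.

(** Zorn's lemma applies to norms on subspaces, ordered by extension and encoded
    by their graphs: a norm on a subspace extends to a complementary line by
    N (x + a v) = N x + |a|, so a maximal one is defined everywhere. It is needed
    because a limit with respect to every norm would otherwise be vacuous, hence
    not unique. *)
Lemma exists_norm : exists N : V -> R, is_norm N.
Proof.
have [G [[P1 P2 P3 P4] max]] := Zorn_bigcup pnorm_chain.
have G0 : G (0, 0).
  have [[[x r] Gx]|nG] := pselect (exists p, G p).
    by have := P4 0 _ _ Gx; rewrite scale0r cabs0 mul0r.
  exfalso; apply: (max [set (0, 0)]).
    split => [p Gp|/(_ (0, 0) erefl) G0]; first by exfalso; apply: nG; exists p.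
    by apply: nG; exists (0, 0).
  split=> [x r s [_ ->] [_ ->]//|x r [-> ->]//|x y r s [-> ->] [-> ->]|a x r [-> ->]].
    by exists 0; rewrite !addr0.
  by rewrite scaler0 mulr0.
have tot v : exists r, G (v, r).
  apply: contrapT => nv.
  pose H : set (V * R) :=
    [set p | exists x r (a : R[i]), G (x, r) /\ p = (x + a *: v, r + cabs a)].
  have sc a : exists r, G (a *: (0 : V), r) by exists (cabs a * 0); exact: P4 G0.
  have Gsub x y r s : G (x, r) -> G (y, s) -> exists t, G (x - y, t).
    move=> Gx /(P4 (-1)); rewrite scaleN1r => Gy.
    by have [t [Gt _]] := P3 _ _ _ _ Gx Gy; exists t.
  (* v is outside the domain of G, which is a subspace: its coefficient in
     an element of the enlarged domain is unique, and H is a function *)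
  have coef x y r s (a b : R[i]) : G (x, r) -> G (y, s) ->
      x + a *: v = y + b *: v -> a = b /\ x = y.
    move=> Gx Gy E; have [ab|ab] := eqVneq a b.
      by split=> //; move: E; rewrite ab => /addIr.
    exfalso; apply: nv; have [t Gt] := Gsub _ _ _ _ Gy Gx.
    exists (cabs (a - b)^-1 * t); have := P4 (a - b)^-1 _ _ Gt.
    suff -> : y - x = (a - b) *: v.
      by rewrite scalerA mulVf ?scale1r// subr_eq0.
    rewrite scalerBl; apply/eqP; rewrite subr_eq addrAC eq_sym subr_eq.
    by rewrite addrC E.
  apply: (max H).
    split=> [[x r] Gx|/(_ (v, 1)) HG].
      by exists x, r, 0; rewrite scale0r cabs0 !addr0.
    apply: nv; exists 1; apply: HG; exists 0, 0, 1; split=> //;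
      rewrite scale1r !add0r; congr (_, _).
    by apply: complexI; rewrite -cabsE normr1.
  split.
  - move=> _ _ s [x [r [a [Gx [-> ->]]]]] [y [r' [b [Gy [E ->]]]]].
    have [-> xy] := coef _ _ _ _ _ _ Gx Gy E.
    by rewrite -xy in Gy; rewrite (P1 _ _ _ Gx Gy).
  - move=> _ _ [x [r [a [Gx [-> ->]]]]]; have [r0 rx] := P2 _ _ Gx; split.
      by rewrite addr_ge0// cabs_ge0.
    move=> /eqP; rewrite paddr_eq0 ?cabs_ge0// cabs_eq0 => /andP[/eqP/rx -> /eqP ->].
    by rewrite scale0r addr0.
  - move=> _ _ _ _ [x [r [a [Gx [-> ->]]]]] [y [s [b [Gy [-> ->]]]]].
    have [t [Gt le]] := P3 _ _ _ _ Gx Gy; exists (t + cabs (a + b)); split.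
      by exists (x + y), t, (a + b); rewrite scalerDl addrACA.
    by rewrite addrACA lerD// ler_cabsD.
  - move=> b _ _ [x [r [a [Gx [-> ->]]]]].
    exists (b *: x), (cabs b * r), (b * a); split; first exact: P4.
    by rewrite scalerDr scalerA mulrDr cabsM.
pose N v := sval (cid (tot v)); have NG v : G (v, N v) := svalP (cid (tot v)).
exists N; split.
- by move=> x; have [] := P2 _ _ (NG x).
- by move=> x; have [_] := P2 _ _ (NG x).
- move=> x y; have [t [Gt le]] := P3 _ _ _ _ (NG x) (NG y).
  by rewrite (P1 _ _ _ (NG (x + y)) Gt).
- by move=> a x; rewrite (P1 _ _ _ (NG (a *: x)) (P4 a _ _ (NG x))) rmorphM/= cabsE.
Qed.
End NormExists.


(** * The ring of formal power series *)

Section FpsRing.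
Variables (K : fieldType) (A : algType K).
Implicit Types (f g h : fps A) (x y : A) (t : K).

HB.instance Definition _ := GRing.Lmodule.copy (fps A) (nat -> A).

Definition fps_one : fps A := fun n => (n == 0%N)%:R.

Lemma fpsDE f g n : (f + g) n = f n + g n. Proof. by []. Qed.
Lemma fpsNE f n : (- f) n = - f n. Proof. by []. Qed.
Lemma fpsZE t f n : (t *: f) n = t *: f n. Proof. by []. Qed.

Let trunc f n := \poly_(i < n.+1) f i.

(** The coefficients up to n only see truncations, so that associativity
    is inherited from polynomials. *)
Lemma fps_mul_poly f g n m : (m <= n)%N ->
  fps_mul f g m = (trunc f n * trunc g n)`_m.
Proof.
move=> mn; rewrite coefM /fps_mul; apply: eq_bigr => i _; rewrite !coef_poly !ltnS.
by rewrite (leq_trans (leq_ord i) mn) (leq_trans (leq_subr _ _) mn).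
Qed.

Lemma fps_mulA : associative (@fps_mul A).
Proof.
move=> f g h; apply: funext => n.
transitivity ((trunc f n * (trunc g n * trunc h n))`_n).
  rewrite coefM; apply: eq_bigr => i _.
  by rewrite coef_poly ltn_ord (@fps_mul_poly _ _ n) ?leq_subr.
rewrite mulrA coefM; apply: eq_bigr => i _.
by rewrite coef_poly ltnS leq_subr -(@fps_mul_poly _ _ n) ?leq_ord.
Qed.

Lemma fps_mul1f : left_id fps_one (@fps_mul A).
Proof.
move=> f; apply: funext => n; rewrite /fps_mul big_ord_recl /fps_one/= subn0 mul1r.
by rewrite big1 ?addr0// => i _; rewrite mul0r.
Qed.

Lemma fps_mulf1 : right_id fps_one (@fps_mul A).
Proof.
move=> f; apply: funext => n; rewrite /fps_mul big_ord_recr /fps_one/= subnn mulr1.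
by rewrite big1 ?add0r// => i _; rewrite subn_eq0 leqNgt ltn_ord mulr0.
Qed.

Lemma fps_mulDl : left_distributive (@fps_mul A) +%R.
Proof.
move=> f g h; apply: funext => n; rewrite fpsDE /fps_mul -big_split/=.
by apply: eq_bigr => i _; rewrite fpsDE mulrDl.
Qed.

Lemma fps_mulDr : right_distributive (@fps_mul A) +%R.
Proof.
move=> f g h; apply: funext => n; rewrite fpsDE /fps_mul -big_split/=.
by apply: eq_bigr => i _; rewrite fpsDE mulrDr.
Qed.

Lemma fps_one_neq0 : fps_one != 0.
Proof. by apply/eqP => /(congr1 (@^~ 0%N)) /eqP; rewrite oner_eq0. Qed.

HB.instance Definition _ := GRing.Zmodule_isNzRing.Build (fps A)
  fps_mulA fps_mul1f fps_mulf1 fps_mulDl fps_mulDr fps_one_neq0.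

Lemma fpsME f g n : (f * g) n = \sum_(k < n.+1) f k * g (n - k)%N.
Proof. by []. Qed.

Lemma fps_scaleAl t f g : t *: (f * g) = (t *: f) * g.
Proof.
apply: funext => n; rewrite fpsZE !fpsME scaler_sumr.
by apply: eq_bigr => i _; rewrite scalerAl.
Qed.

Lemma fps_scaleAr t f g : t *: (f * g) = f * (t *: g).
Proof.
apply: funext => n; rewrite fpsZE !fpsME scaler_sumr.
by apply: eq_bigr => i _; rewrite scalerAr.
Qed.

HB.instance Definition _ := GRing.Lmodule_isLalgebra.Build K (fps A) fps_scaleAl.
HB.instance Definition _ := GRing.Lalgebra_isAlgebra.Build K (fps A) fps_scaleAr.

Lemma fps_mulE f g : f *_fps g = f * g. Proof. by []. Qed.
Lemma fps1E n : (1 : fps A) n = (n == 0%N)%:R. Proof. by []. Qed.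

(** The series with x in degree 1, that is lambda x: with it, a differential
    equation that raises the power of lambda is an identity in A[[lambda]]. *)
Definition lam x : fps A := fun n => if n == 1%N then x else 0.

Lemma lamMl x f n : (lam x * f) n = if n is m.+1 then x * f m else 0.
Proof.
rewrite fpsME; case: n => [|n]; first by rewrite big_ord1 mul0r.
rewrite big_ord_recl mul0r add0r big_ord_recl/= subSS subn0.
by rewrite big1 ?addr0// => i _; rewrite /lam/= mul0r.
Qed.

Lemma lamMr x f n : (f * lam x) n = if n is m.+1 then f m * x else 0.
Proof.
rewrite fpsME; case: n => [|n]; first by rewrite big_ord1 mulr0.
rewrite !big_ord_recr/= subSnn subnn mulr0 addr0 big1 ?add0r// => i _.
by rewrite /lam/= subSn 1?ltnW// eqSS subn_eq0 leqNgt ltn_ord mulr0.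
Qed.

Lemma lamD x y : lam (x + y) = lam x + lam y.
Proof. by apply: funext => -[|[|n]]; rewrite fpsDE /lam /= ?addr0. Qed.

(** The coefficients of the quotient are found one after the other; s n lists
    the first n of them. *)
Lemma fps_div f g : f 0%N = 1 -> exists k, g = f * k.
Proof.
move=> f0.
pose step (s : seq A) :=
  rcons s (g (size s) - \sum_(i < size s) f (size s - i)%N * s`_i).
pose s n := iter n step [::].
have ss n : size (s n) = n by elim: n => //= n IH; rewrite /step size_rcons IH.
have snth n m i : (i < n)%N -> (n <= m)%N -> (s m)`_i = (s n)`_i.
  move=> ilt /subnK <-; elim: (m - n)%N => //= p IH.
  by rewrite nth_rcons ss (leq_trans ilt) ?leq_addl.
exists (fun n => (s n.+1)`_n); apply: funext => n.
rewrite fpsME (reindex_inj rev_ord_inj)/= big_ord_recr/= !subSS subnn f0 mul1r subn0.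
rewrite nth_rcons ss ltnn eqxx addrC.
rewrite (_ : \sum_(i < n) _ = \sum_(i < n) f (n - i)%N * (s n)`_i) ?subrK//.
apply: eq_bigr => i _; rewrite subSS subKn 1?ltnW//.
by rewrite (@snth i.+1 n).
Qed.

Lemma fps_inv f : f 0%N = 1 -> exists k, f * k = 1 /\ k * f = 1.
Proof.
move=> f0; have [k fk] := fps_div 1 f0.
have k0 : k 0%N = 1.
  by have := congr1 (@^~ 0%N) fk; rewrite fpsME big_ord1/= f0 mul1r => <-.
have [l kl] := fps_div 1 k0; exists k; split=> //.
have -> : f = l by rewrite -[LHS]mulr1 kl mulrA -fk mul1r.
by rewrite -kl.
Qed.

Lemma fps_mulI f g h : f 0%N = 1 -> f * g = f * h -> g = h.
Proof.
by move=> /fps_inv[k [_ kf]] E; rewrite -[g]mul1r -[h]mul1r -kf -!mulrA E.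
Qed.

End FpsRing.


(** * Derivatives of finite-rank functions *)

Section FiniteRank.
Variable R : realType.

(** V carries no topology, and none is needed: each coefficient of each series
    of interest is a finite sum of scalar functions times fixed vectors, and f' is
    obtained by differentiating the scalars. *)
Definition frderiv (V : lmodType R[i]) (a b : R) (f f' : R -> V) : Prop :=
  exists (I : finType) (phi phi' : I -> R -> R) (v : I -> V),
  [/\ forall i, {within `[a, b], continuous (phi i)},
      forall i x, x \in `]a, b[ -> is_derive x 1 (phi i) (phi' i x),
      forall x, x \in `[a, b] -> f x = \sum_i (phi i x)%:C *: v i
    & forall x, x \in `]a, b[ -> f' x = \sum_i (phi' i x)%:C *: v i].

Section Module.
Variable V : lmodType R[i].
Implicit Types (a b : R) (f g : R -> V).

Lemma frderiv_ext a b f f' g g' :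
    {in `[a, b], f =1 g} -> {in `]a, b[, f' =1 g'} ->
  frderiv a b f f' -> frderiv a b g g'.
Proof.
move=> fg fg' [I [p [p' [v [c d e e']]]]]; exists I, p, p', v; split=> // x xab.
  by rewrite -fg// e.
by rewrite -fg'// e'.
Qed.

Lemma frderiv1 a b (phi phi' : R -> R) (v : V) :
    {within `[a, b], continuous phi} ->
    (forall x, x \in `]a, b[ -> is_derive x 1 phi (phi' x)) ->
  frderiv a b (fun x => (phi x)%:C *: v) (fun x => (phi' x)%:C *: v).
Proof.
move=> c d; exists unit, (fun=> phi), (fun=> phi'), (fun=> v).
by split=> // x xab; rewrite big_const card_unit /= addr0.
Qed.

Lemma frderiv_cst a b (v : V) : frderiv a b (fun=> v) (fun=> 0).
Proof.
apply: (@frderiv_ext _ _ (fun x => (cst 1 x)%:C *: v)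
                     (fun x => (cst 0 x)%:C *: v)).
- by move=> x _; rewrite scale1r.
- by move=> x _; rewrite scale0r.
- apply: (@frderiv1 a b (cst 1) (cst 0)).
  by apply: continuous_subspaceT; exact: cst_continuous.
Qed.

Lemma frderivD a b f f' g g' : frderiv a b f f' -> frderiv a b g g' ->
  frderiv a b (fun x => f x + g x) (fun x => f' x + g' x).
Proof.
move=> [I [p [p' [v [c d e e']]]]] [J [q [q' [w [c1 d1 e1 e1']]]]].
exists (I + J)%type, (fun i => match i with inl i => p i | inr j => q j end),
  (fun i => match i with inl i => p' i | inr j => q' j end),
  (fun i => match i with inl i => v i | inr j => w j end).
split=> [[i|j]//|[i|j] x xab|x xab|x xab]; [exact: d|exact: d1| |].
  by rewrite big_sumType/= e// e1.
by rewrite big_sumType/= e'// e1'.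
Qed.

Lemma frderivZ a b (k : R[i]) f f' : frderiv a b f f' ->
  frderiv a b (fun x => k *: f x) (fun x => k *: f' x).
Proof.
move=> [I [p [p' [v [c d e e']]]]]; exists I, p, p', (fun i => k *: v i).
split=> // x xab; rewrite ?e ?e'// scaler_sumr.
  by apply: eq_bigr => i _; rewrite !scalerA mulrC.
by apply: eq_bigr => i _; rewrite !scalerA mulrC.
Qed.

Lemma frderivB a b f f' g g' : frderiv a b f f' -> frderiv a b g g' ->
  frderiv a b (fun x => f x - g x) (fun x => f' x - g' x).
Proof.
move=> df /(frderivZ (-1)) dg; apply: frderiv_ext (frderivD df dg) => x _ /=;
  by rewrite scaleN1r.
Qed.

Lemma frderiv_sum a b (I : Type) (r : seq I) (P : pred I) (f f' : I -> R -> V) :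
    (forall i, P i -> frderiv a b (f i) (f' i)) ->
  frderiv a b (fun x => \sum_(i <- r | P i) f i x)
              (fun x => \sum_(i <- r | P i) f' i x).
Proof.
move=> df; elim: r => [|i r IH].
  by apply: frderiv_ext (frderiv_cst a b 0) => x _; rewrite big_nil.
case: (boolP (P i)) => Pi.
  by apply: frderiv_ext (frderivD (df i Pi) IH) => x _; rewrite big_cons Pi.
by apply: frderiv_ext IH => x _; rewrite big_cons (negbTE Pi).
Qed.

Lemma frderiv_sub a b c d f f' : a <= c -> d <= b ->
  frderiv a b f f' -> frderiv c d f f'.
Proof.
move=> ac db [I [p [p' [v [k l e e']]]]]; exists I, p, p', v; split.
- by move=> i; apply: continuous_subspaceW (k i); apply: subset_itvScc;
  rewrite bnd_simp.
- by move=> i x xcd; apply: l; exact: (subset_itvW _ _ ac db) xcd.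
- by move=> x xcd; apply: e; apply: subset_itvScc xcd; rewrite bnd_simp.
- by move=> x xcd; apply: e'; exact: (subset_itvW _ _ ac db) xcd.
Qed.

(** Where some p' i0 does not vanish, v i0 is a combination of the other
    vectors. Substituting it lowers the number of vectors and keeps the
    hypotheses. When all derivatives vanish, the mean value theorem concludes. *)
Let elimination (I : finType) (v : I -> V) a b : a <= b ->
  forall n (P : {set I}) (p p' : I -> R -> R), (#|P| <= n)%N ->
    (forall i, {within `[a, b], continuous (p i)}) ->
    (forall i x, x \in `]a, b[ -> is_derive x 1 (p i) (p' i x)) ->
    (forall x, x \in `]a, b[ -> \sum_(i in P) (p' i x)%:C *: v i = 0) ->
  \sum_(i in P) (p i b - p i a)%:C *: v i = 0.
Proof.
move=> ab; elim=> [|n IH] P p p' leP c d s0.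
  by rewrite big1// => i; move: leP; rewrite leqn0 cards_eq0 => /eqP ->; rewrite inE.
have [z|nz] := pselect (forall i x, i \in P -> x \in `]a, b[ -> p' i x = 0).
  rewrite big1// => i iP.
  have := @MVT_segment _ (p i) (fun=> 0) a b ab.
  case=> [x xab|//|x _ ->]; last by rewrite mul0r scale0r.
  by rewrite -(z i x)//; exact: d.
move: nz => /existsNP[i0 /existsNP[x0 /not_implyP[i0P /not_implyP[x0ab /eqP nz]]]].
pose c0 i := - (p' i x0 / p' i0 x0).
have vi0 : v i0 = \sum_(i in P :\ i0) (c0 i)%:C *: v i.
  have := s0 _ x0ab; rewrite (big_setD1 i0)//= => /eqP.
  rewrite addr_eq0 => /eqP/(congr1 (GRing.scale (p' i0 x0)^-1%:C)).
  rewrite scalerA -rmorphM/= mulVf// rmorph1 scale1r => ->.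
  rewrite -sumrN scaler_sumr; apply: eq_bigr => i _.
  by rewrite scalerN scalerA -rmorphM -scaleNr /c0 [in RHS]rmorphN/= mulrC.
rewrite (big_setD1 i0)//= {1}vi0 scaler_sumr -big_split/=.
have := IH (P :\ i0) (fun i y => p i y + c0 i * p i0 y) (fun i x => p' i x + c0
  i * p' i0 x).
move=> H; rewrite -[RHS]H => {H}.
- apply: eq_bigr => i _; rewrite scalerA -scalerDl -rmorphM -rmorphD/=.
  by congr (_ %:C *: _); ring.
- by move: leP; rewrite (cardsD1 i0) i0P.
- move=> i x; apply: cvgD; [exact: c|apply: cvgMl_tmp; exact: c].
- by move=> i x xab; apply: is_deriveD; [exact: d|apply: is_deriveZ; exact: d].
- move=> x xab; rewrite -[RHS](s0 x xab) [in RHS](big_setD1 i0)//= {1}vi0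
  scaler_sumr -big_split/=.
  apply: eq_bigr => i _; rewrite scalerA -scalerDl -rmorphM -rmorphD/=.
  by congr (_ %:C *: _); ring.
Qed.

(** The derivative may vanish although no scalar derivative does, because the
    vectors may be dependent; elimination handles this. *)
Lemma frderiv0_cst a b f f' : a <= b -> frderiv a b f f' ->
  (forall x, x \in `]a, b[ -> f' x = 0) -> f b = f a.
Proof.
move=> ab [I [p [p' [v [c d e e']]]]] f'0.
have /(_ _ [set: I]%SET _ _ (leqnn _) c d) H := @elimination I v a b ab.
apply/eqP; rewrite -subr_eq0 !e ?in_itv/= ?lexx ?ab//; apply/eqP.
rewrite -sumrB; transitivity (\sum_(i in [set: I]%SET) (p i b - p i a)%:C *: v i).
  by apply: eq_big => [i|i _]; rewrite ?inE// -scalerBl -rmorphB.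
apply: H => x xab; rewrite -[RHS](f'0 x xab) e'//.
by apply: eq_bigl => i; rewrite inE.
Qed.

End Module.

Section Algebra.
Variable A : algType R[i].
Implicit Types (a b : R) (f g : R -> A).

Lemma frderivM a b f f' g g' : frderiv a b f f' -> frderiv a b g g' ->
  frderiv a b (fun x => f x * g x) (fun x => f' x * g x + f x * g' x).
Proof.
move=> [I [p [p' [v [c d e e']]]]] [J [q [q' [w [c1 d1 e1 e1']]]]].
exists (I * J)%type, (fun ij => p ij.1 * q ij.2),
  (fun ij x => p ij.1 x * q' ij.2 x + q ij.2 x * p' ij.1 x),
  (fun ij => v ij.1 * w ij.2); split.
- by move=> [i j] x /=; apply: cvgM; [exact: c|exact: c1].
- by move=> [i j] x xab; apply: is_deriveM; [exact: d|exact: d1].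
- move=> x xab; rewrite e// e1// mulr_suml.
  under eq_bigr do rewrite mulr_sumr; rewrite pair_big/=.
  by apply: eq_bigr => -[i j] _ /=; rewrite -scalerAl -scalerAr scalerA -rmorphM.
- move=> x xab; rewrite e'// e1'//; have xab' := subset_itv_oo_cc xab.
  rewrite e// e1// !mulr_suml -big_split/=.
  under eq_bigr do rewrite !mulr_sumr -big_split/=; rewrite pair_big/=.
  apply: eq_bigr => -[i j] _ /=; rewrite -!scalerAl -!scalerAr !scalerA -scalerDl.
  by rewrite -!rmorphM -rmorphD/=; congr (_%:C *: _); ring.
Qed.

End Algebra.

End FiniteRank.


(** * Geometrically dominated complex series *)

Section GeometricSums.
Variable R : realType.
Implicit Types (u v : nat -> R[i]) (M q : R).

(** All series used here converge geometrically; this class is closed under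
    all operations needed, and gives absolute convergence at once. *)
Definition geo_dominated M q u :=
  [/\ 0 <= M, 0 <= q < 1 & forall n, cabs (u n) <= M * q ^+ n].

Definition geo_summable u := exists M q, geo_dominated M q u.

Definition csum u : R[i] :=
  limn (series (fun n => complex.Re (u n))) +i*
  limn (series (fun n => complex.Im (u n))).

Let real_sum (u : nat -> R) M q : 0 <= q < 1 ->
    (forall n, `|u n| <= M * q ^+ n) ->
  cvgn (series u) /\ `|limn (series u)| <= M / (1 - q).
Proof.
move=> /andP[q0 q1] uM.
have cg := @is_cvg_geometric_series R M q; rewrite ger0_norm// in cg.
have cn : cvgn [normed series u].
  apply: (@series_le_cvg _ _ (geometric M q)) (cg q1) => n.
  - exact: normr_ge0.
  - by rewrite (le_trans _ (uM n)).
  - exact: uM.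
split; first exact: normed_cvg.
apply: (le_trans (lim_series_norm cn)).
have <- : limn (series (geometric M q)) = M / (1 - q).
  by apply: cvg_lim => //; apply: cvg_geometric_series; rewrite ger0_norm.
by apply: lim_series_le => //; exact: cg.
Qed.

Let cvgRe u M q : geo_dominated M q u -> cvgn (series (fun n => complex.Re (u n))) /\
  `|limn (series (fun n => complex.Re (u n)))| <= M / (1 - q).
Proof.
move=> [_ q01 uM]; apply: real_sum => // n.
by rewrite (le_trans (Re_le_cabs _)).
Qed.

Let cvgIm u M q : geo_dominated M q u -> cvgn (series (fun n => complex.Im (u n))) /\
  `|limn (series (fun n => complex.Im (u n)))| <= M / (1 - q).
Proof.
move=> [_ q01 uM]; apply: real_sum => // n.
by rewrite (le_trans (Im_le_cabs _)).
Qed.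

Lemma csum_bound u M q : geo_dominated M q u -> cabs (csum u) <= 2 * (M / (1 - q)).
Proof.
move=> uM; rewrite (le_trans (ler_cabs_ReIm _))//= mulr_natl mulr2n lerD//.
  by have [] := cvgRe uM.
by have [] := cvgIm uM.
Qed.

Lemma csumD u v : geo_summable u -> geo_summable v ->
  csum (fun n => u n + v n) = csum u + csum v.
Proof.
move=> [M [q uM]] [N [r vN]]; rewrite /csum.
have [cu _] := cvgRe uM; have [cu' _] := cvgIm uM.
have [cv _] := cvgRe vN; have [cv' _] := cvgIm vN.
apply: complex_eqP; rewrite ?cReD ?cImD /=.
  by under eq_fun do rewrite cReD; rewrite -lim_seriesD.
by under eq_fun do rewrite cImD; rewrite -lim_seriesD.
Qed.

Lemma csumZ k u : geo_summable u -> csum (fun n => k * u n) = k * csum u.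
Proof.
move=> [M [q uM]]; rewrite /csum.
have [cu _] := cvgRe uM; have [cu' _] := cvgIm uM.
apply: complex_eqP; rewrite ?cReM ?cImM /=.
  under eq_fun do rewrite cReM.
  rewrite -[X in X - _]lim_seriesZ// -[X in _ - X]lim_seriesZ// -lim_seriesB//;
    exact: is_cvg_seriesZ.
under eq_fun do rewrite cImM.
rewrite -[X in X + _]lim_seriesZ// -[X in _ + X]lim_seriesZ// -lim_seriesD//;
  exact: is_cvg_seriesZ.
Qed.

Let lim_series_recl (u : nat -> R) : cvgn (series u) ->
  limn (series u) = u 0%N + limn (series (fun n => u n.+1)).
Proof.
move=> cu.
have E : series (fun n => u n.+1) = (fun n => series u n.+1 - u 0%N).
  by apply: funext => n; rewrite /series/= big_nat_recl// addrAC subrr add0r.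
have cS : series u n.+1 @[n --> \oo] --> limn (series u).
  by have := cu; rewrite -(cvg_shiftS (series u)).
rewrite E; have -> : limn (fun n => series u n.+1 - u 0%N) = limn (series u) - u 0%N.
  by apply: cvg_lim => //; apply: cvgB => //; exact: cvg_cst.
by rewrite addrC subrK.
Qed.

Lemma csum_recl u : geo_summable u -> csum u = u 0%N + csum (fun n => u n.+1).
Proof.
move=> [M [q uM]]; rewrite /csum.
have [cu _] := cvgRe uM; have [cu' _] := cvgIm uM.
by rewrite (lim_series_recl cu) (lim_series_recl cu'); case: (u 0%N).
Qed.

Lemma geo_summableI M q u : 0 <= M -> 0 <= q < 1 ->
  (forall n, cabs (u n) <= M * q ^+ n) -> geo_summable u.
Proof. by move=> *; exists M, q. Qed.

Lemma geo_summableD u v : geo_summable u -> geo_summable v ->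
  geo_summable (fun n => u n + v n).
Proof.
move=> [M [q [M0 /andP[q0 q1] uM]]] [N [r [N0 /andP[r0 r1] vN]]].
apply: (@geo_summableI (M + N) (Num.max q r)).
- by rewrite addr_ge0.
- by rewrite le_max q0 gt_max q1 r1.
- move=> n; rewrite (le_trans (ler_cabsD _ _))// mulrDl lerD//.
    rewrite (le_trans (uM n))// ler_wpM2l// lerXn2r ?nnegrE// ?le_max ?q0 ?lexx//.
  by rewrite (le_trans (vN n))// ler_wpM2l// lerXn2r ?nnegrE// ?le_max ?q0 ?lexx// orbT.
Qed.

Lemma geo_summableZ k u : geo_summable u -> geo_summable (fun n => k * u n).
Proof.
move=> [M [q [M0 q01 uM]]]; apply: (@geo_summableI (cabs k * M) q) => //.
  by rewrite mulr_ge0// cabs_ge0.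
by move=> n; rewrite cabsM -mulrA ler_wpM2l// cabs_ge0.
Qed.

Lemma geo_summableS u : geo_summable u -> geo_summable (fun n => u n.+1).
Proof.
move=> [M [q [M0 q01 uM]]]; apply: (@geo_summableI (M * q) q) => //.
  by rewrite mulr_ge0//; case/andP: q01.
by move=> n; rewrite -mulrA -exprS.
Qed.

(** From the factorization of tau^(n+1) - q^(n+1), whose n+1 terms are at least
    q^n. It trades the polynomial factor of a differentiated series for a slightly
    larger ratio. *)
Lemma ler_nXn (q tau : R) n : 0 <= q < tau ->
  n%:R * q ^+ n <= tau / (tau - q) * tau ^+ n.
Proof.
move=> /andP[q0 qt]; have tq0 : 0 < tau - q by rewrite subr_gt0.
rewrite mulrAC -exprS ler_pdivlMr//.
suff : (n.+1)%:R * q ^+ n * (tau - q) <= tau ^+ n.+1 - q ^+ n.+1.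
  move=> H; have qn : 0 <= q ^+ n by rewrite exprn_ge0.
  have qn1 : 0 <= q ^+ n.+1 by rewrite exprn_ge0.
  rewrite -natr1 in H; nra.
elim: n => [|n IH]; first by rewrite expr0 !expr1 !mul1r.
have tn : q ^+ n.+1 <= tau ^+ n.+1.
  by rewrite lerXn2r ?nnegrE// ltW// (le_lt_trans q0).
have := ler_wpM2l q0 IH; rewrite (exprS tau n.+1) (exprS q n.+1) -[n.+2%:R]natr1.
have : 0 <= (tau - q) * (tau ^+ n.+1 - q ^+ n.+1) by rewrite mulr_ge0 ?subr_ge0// ltW.
rewrite (exprS q n); move: (tau ^+ n.+1) (q ^+ n) (n.+1%:R) => T Q N; nra.
Qed.

End GeometricSums.


(** * Curves and holomorphic functions *)

Section Holomorphic.
Variable R : realType.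
Implicit Types (p : R -> R[i]) (phi : R[i] -> R[i]) (x y : R) (z d : R[i]).

Definition cderiv p x d :=
  is_derive x 1 (fun y => complex.Re (p y)) (complex.Re d) /\
  is_derive x 1 (fun y => complex.Im (p y)) (complex.Im d).

(** The quadratic error term, rather than o(h), is what power series provide. *)
Definition hol phi z d := exists (M delta : R), [/\ 0 <= M, 0 < delta &
  forall h, cabs h <= delta ->
    cabs (phi (z + h) - phi z - d * h) <= M * cabs h ^+ 2].

Lemma cderiv_eq p x d d' : cderiv p x d -> d = d' -> cderiv p x d'.
Proof. by move=> + <-. Qed.

Let is_derive_affine (r s x : R) : is_derive x 1 (fun y => r + s * y) s.
Proof.
have H := is_deriveD (is_derive_cst r x 1) (is_deriveZ s (is_derive_id x (1 : R))).
by apply: (is_derive_eq H); rewrite add0r /GRing.scale/= mulr1.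
Qed.

Lemma cderiv_affine (u v : R[i]) x : cderiv (fun y => u + v * y%:C) x v.
Proof.
split.
  under eq_fun do rewrite cReD cReM/= mulr0 subr0; exact: is_derive_affine.
under eq_fun do rewrite cImD cImM/= mulr0 add0r; exact: is_derive_affine.
Qed.

Lemma frderiv_cderiv (V : lmodType R[i]) (a b : R) p p' (v : V) :
    {in `[a, b], forall x, cderiv p x (p' x)} ->
  frderiv a b (fun x => p x *: v) (fun x => p' x *: v).
Proof.
move=> dp.
have cont (q q' : R -> R) : {in `[a, b], forall x, is_derive x 1 q (q' x)} ->
    {within `[a, b], continuous q}.
  move=> dq; apply: continuous_in_subspaceT => x; rewrite inE => xab.
  by apply: differentiable_continuous; apply/derivable1_diffP; have [] := dq x xab.
have dRe : {in `[a, b], forall x, is_derive x 1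
    (fun y => complex.Re (p y)) (complex.Re (p' x))} by move=> x /dp[].
have dIm : {in `[a, b], forall x, is_derive x 1
    (fun y => complex.Im (p y)) (complex.Im (p' x))} by move=> x /dp[].
have E (q : R -> R[i]) x : q x *: v =
    (complex.Re (q x))%:C *: v + (complex.Im (q x))%:C *: ('i *: v).
  by rewrite scalerA -scalerDl mulrC -complexReIm.
apply: (@frderiv_ext _ _ _ _
  (fun x => (complex.Re (p x))%:C *: v + (complex.Im (p x))%:C *: ('i *: v))
  (fun x => (complex.Re (p' x))%:C *: v + (complex.Im (p' x))%:C *: ('i *: v))).
- by move=> x _; rewrite -E.
- by move=> x _; rewrite -E.
apply: frderivD.
- by apply: frderiv1; [exact: cont dRe|move=> x xab; apply: dRe;
  exact: subset_itv_oo_cc].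
- by apply: frderiv1; [exact: cont dIm|move=> x xab; apply: dIm;
  exact: subset_itv_oo_cc].
Qed.

(** It is used with q the square of a distance, to discard the error term of
    the chain rule without introducing complex derivatives. *)
Lemma is_derive0_squeeze (g q : R -> R) x (M : R) :
    is_derive x 1 q 0 -> q x = 0 ->
    (\forall y \near x, `|g y| <= M * `|q y|) ->
  is_derive x 1 g 0.
Proof.
move=> [dq q'0] qx gq.
have gx : g x = 0.
  by have := nbhs_singleton gq; rewrite qx normr0 mulr0 normr_le0 => /eqP.
have cq : h^-1 *: ((q \o shift x) (h *: (1 : R)) - q x) @[h --> 0^'] --> (0 : R).
  by rewrite [X in _ --> X](_ : _ = 'D_1 q x)//; exact: dq.
have cg : h^-1 *: ((g \o shift x) (h *: (1 : R)) - g x) @[h --> 0^'] --> (0 : R).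
  apply/cvgr0Pnorm_le => e e0.
  have e1 : 0 < e / (`|M| + 1) by rewrite divr_gt0// ltr_wpDl.
  have /cvgr0Pnorm_le/(_ _ e1) := cq.
  have near1 : \forall h \near 0^', `|g (h + x)| <= M * `|q (h + x)|.
    have /nbhs_ballP[r/= r0 br] := gq.
    apply/nbhs_ballP; exists r => //= h; rewrite /ball/= sub0r normrN => hr _.
    by apply: br; rewrite /ball/= opprD addrCA subrr addr0 normrN.
  apply: filterS2 near1 => h gqh /=.
  have hA : h *: (1 : R) = h by rewrite /GRing.scale/= mulr1.
  rewrite qx gx !subr0 /= /shift/= hA !normrZ => qe.
  apply: (@le_trans _ _ (`|M| * (`|h^-1| * `|q (h + x)|))).
    rewrite mulrCA ler_wpM2l//; apply: (le_trans gqh).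
    by rewrite ler_wpM2r// ler_norm.
  apply: (le_trans (ler_wpM2l (normr_ge0 M) qe)).
  rewrite mulrCA ler_piMr ?(ltW e0)// ler_pdivrMr ?ltr_wpDl//.
  by rewrite mul1r lerDl.
split; first by apply/cvg_ex; exists 0.
by apply: cvg_lim.
Qed.

Lemma cderiv_continuous p x d (e : R) : 0 < e -> cderiv p x d ->
  \forall y \near x, cabs (p y - p x) <= e.
Proof.
move=> e0 [[dRe _] [dIm _]].
have /derivable1_diffP/differentiable_continuous cRe := dRe.
have /derivable1_diffP/differentiable_continuous cIm := dIm.
have e2 : 0 < e / 2 by rewrite divr_gt0.
move/cvgrPdist_le : cRe => /(_ _ e2) nRe.
move/cvgrPdist_le : cIm => /(_ _ e2) nIm.
apply: filterS2 nRe nIm => y hRe hIm.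
rewrite (le_trans (ler_cabs_ReIm _))// (splitr e) lerD//.
  by case: (p x) (p y) hRe => a b [c f] /=; rewrite distrC.
by case: (p x) (p y) hIm => a b [c f] /=; rewrite distrC.
Qed.

(** The error phi (p y) - phi (p x) - e (p y - p x) is at most a constant times
    |p y - p x|^2, a real function that is differentiable and has a double zero
    at x. *)
Lemma cderiv_comp p phi x d e :
  cderiv p x d -> hol phi (p x) e -> cderiv (fun y => phi (p y)) x (e * d).
Proof.
move=> dp [M [delta [M0 del0 H]]].
pose q y := cabs (p y - p x) ^+ 2.
have dq : is_derive x 1 q 0.
  have [dRe dIm] := dp.
  have D1 := is_deriveX 2 (is_deriveB dRe (is_derive_cst (complex.Re (p x)) x 1)).
  have D2 := is_deriveX 2 (is_deriveB dIm (is_derive_cst (complex.Im (p x)) x 1)).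
  have -> : q = (((fun y => complex.Re (p y)) - cst (complex.Re (p x))) ^+ 2 +
     ((fun y => complex.Im (p y)) - cst (complex.Im (p x))) ^+ 2).
    apply: funext => y; rewrite /q sqr_cabs !fctE.
    by case: (p y) (p x) => a b [c f].
  by apply: (is_derive_eq (is_deriveD D1 D2));
    rewrite !fctE !subrr /= !expr1 !mulr0 !scale0r addr0.
have qx : q x = 0 by rewrite /q subrr cabs0 expr0n.
pose err y := phi (p y) - phi (p x) - e * (p y - p x).
have Eerr : \forall y \near x, cabs (err y) <= M * `|q y|.
  have := cderiv_continuous del0 dp; apply: filterS => y /H.
  by rewrite [p x + _]addrC subrK ger0_norm ?exprn_ge0// cabs_ge0.
have dR : is_derive x 1 (fun y => complex.Re (err y)) 0.
  apply: (is_derive0_squeeze dq qx (M := M)); apply: filterS Eerr => y.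
  exact/le_trans/Re_le_cabs.
have dI : is_derive x 1 (fun y => complex.Im (err y)) 0.
  apply: (is_derive0_squeeze dq qx (M := M)); apply: filterS Eerr => y.
  exact/le_trans/Im_le_cabs.
pose c := phi (p x) - e * p x.
have E y : phi (p y) = err y + c + e * p y by rewrite /err /c; ring.
have EcR y : complex.Re (phi (p y)) = complex.Re (err y) + complex.Re c +
    complex.Re e * complex.Re (p y) - complex.Im e * complex.Im (p y).
  by rewrite E !cReD cReM addrA.
have EcI y : complex.Im (phi (p y)) = complex.Im (err y) + complex.Im c +
    complex.Re e * complex.Im (p y) + complex.Im e * complex.Re (p y).
  by rewrite E !cImD cImM addrA.
have [dRe dIm] := dp; split.
  have -> : (fun y => complex.Re (phi (p y))) = (fun y => complex.Re (err y)) +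
      cst (complex.Re c) + (complex.Re e \*: (fun y => complex.Re (p y)))
      - (complex.Im e \*: (fun y => complex.Im (p y))).
    by apply: funext => y; exact: EcR.
  apply: (is_derive_eq (is_deriveB (is_deriveD (is_deriveD dR (is_derive_cst _ _ _))
    (is_deriveZ _ dRe)) (is_deriveZ _ dIm))).
  by rewrite cReM !add0r.
have -> : (fun y => complex.Im (phi (p y))) = (fun y => complex.Im (err y)) +
    cst (complex.Im c) + (complex.Re e \*: (fun y => complex.Im (p y)))
    + (complex.Im e \*: (fun y => complex.Re (p y))).
  by apply: funext => y; exact: EcI.
apply: (is_derive_eq (is_deriveD (is_deriveD (is_deriveD dI (is_derive_cst _ _ _))
  (is_deriveZ _ dIm)) (is_deriveZ _ dRe))).
by rewrite cImM !add0r.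
Qed.

Lemma hol_inv z : z != 0 -> hol (fun w => w^-1) z (- z ^- 2).
Proof.
move=> z0; have cz0 : 0 < cabs z by rewrite lt_neqAle eq_sym cabs_eq0 z0 cabs_ge0.
exists (2 / cabs z ^+ 3), (cabs z / 2); split.
- by rewrite divr_ge0// exprn_ge0// ltW.
- by rewrite divr_gt0.
move=> h hz; have : cabs z / 2 <= cabs (z + h).
  have := ler_cabsD (z + h) (- h); rewrite addrK cabsN => H; lra.
move=> zh; have zhp : 0 < cabs (z + h) by rewrite (lt_le_trans _ zh)// divr_gt0.
have zh0 : z + h != 0 by rewrite -cabs_eq0 gt_eqF.
have -> : (z + h)^-1 - z^-1 - (- z ^- 2) * h = h ^+ 2 * z ^- 2 * (z + h)^-1.
  by field; rewrite zh0 z0.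
rewrite !cabsM [cabs (z + h)^-1]cabsV [cabs (z ^- 2)]cabsV !cabsX.
have zV : (cabs (z + h))^-1 <= 2 / cabs z.
  by rewrite -[2 / _]invf_div lef_pV2 ?posrE ?divr_gt0.
apply: (le_trans (ler_wpM2l _ zV)).
  by rewrite divr_ge0 ?mulr_ge0 ?exprn_ge0 ?cabs_ge0.
by rewrite le_eqVlt; apply/orP; left; apply/eqP; field; rewrite gt_eqF.
Qed.

End Holomorphic.


(** * Power series *)

Section PowerSeries.
Variables (R : realType) (b : R).
Hypothesis b0 : 0 < b.
Implicit Types (c : nat -> R[i]) (z : R[i]).

Definition psum c z := csum (fun n => c n * z ^+ n).

(** Coefficients of a power series that converges for b |z| < 1, with a bound
    instead of a radius of convergence. *)
Definition geo_coef c := exists2 M, 0 <= M & forall n, cabs (c n) <= M * b ^+ n.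

Let bz z : b * cabs z < 1 -> 0 <= b * cabs z < 1.
Proof. by move=> ->; rewrite mulr_ge0 ?cabs_ge0// ltW. Qed.

Lemma geo_summable_psum c z : geo_coef c -> b * cabs z < 1 ->
  geo_summable (fun n => c n * z ^+ n).
Proof.
move=> [M M0 cM] bz1; apply: (geo_summableI M0 (bz bz1)) => n.
by rewrite cabsM cabsX exprMn mulrA ler_wpM2r// exprn_ge0// cabs_ge0.
Qed.

Lemma psum0 c : geo_coef c -> psum c 0 = c 0%N.
Proof.
move=> gc; rewrite /psum csum_recl; last first.
  by apply: geo_summable_psum => //; rewrite cabs0 mulr0.
rewrite mulr1 (_ : (fun n => _) = (fun n : nat => 0 * (0 : R[i]))).
  rewrite csumZ ?mul0r ?addr0//.
  by apply: (@geo_summableI _ 0 0) => // [|n]; rewrite ?lexx ?ltr01// cabs0 mul0r.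
by apply: funext => n; rewrite exprS !mul0r mulr0.
Qed.

Lemma psum_recl c z : geo_coef c -> b * cabs z < 1 ->
  psum c z = c 0%N + z * psum (fun n => c n.+1) z.
Proof.
move=> gc bz1; have sc := geo_summable_psum gc bz1;
  rewrite /psum csum_recl// mulr1; congr (_ + _).
have sS := geo_summableS sc; have [->|z0] := eqVneq z 0.
  rewrite mul0r (_ : (fun n => _) = (fun n : nat => 0 * (0 : R[i]))).
    rewrite csumZ ?mul0r//.
    by apply: (@geo_summableI _ 0 0) => // [|n]; rewrite ?lexx ?ltr01// cabs0 mul0r.
  by apply: funext => n; rewrite exprS !mul0r mulr0.
rewrite -csumZ; last first.
  have := geo_summableZ z^-1 sS; congr geo_summable; apply: funext => n; rewrite exprS.
  by rewrite mulrCA mulKf.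
by congr csum; apply: funext => n; rewrite exprS; ring.
Qed.

(** The factor rho^2 avoids negative exponents of rho for n < 2. *)
Let taylor (z h : R[i]) (rho : R) n : cabs z <= rho -> cabs (z + h) <= rho ->
  rho ^+ 2 * cabs ((z + h) ^+ n - z ^+ n - n%:R * z ^+ n.-1 * h) <=
  n%:R ^+ 2 * rho ^+ n * cabs h ^+ 2.
Proof.
move=> zr zhr; have r0 : 0 <= rho := le_trans (cabs_ge0 _) zr.
elim: n => [|n IH].
  by rewrite subrr sub0r mul0r mul0r oppr0 cabs0 mulr0 expr0n/= !mul0r.
have -> : (z + h) ^+ n.+1 - z ^+ n.+1 - n.+1%:R * z ^+ n.+1.-1 * h =
    (z + h) * ((z + h) ^+ n - z ^+ n - n%:R * z ^+ n.-1 * h) +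
    n%:R * z ^+ n.-1 * h ^+ 2.
  case: n {IH} => [|n] /=; first by rewrite !expr0 !expr1; ring.
  by rewrite !exprS -!natr1; ring.
apply: (le_trans (ler_wpM2l (exprn_ge0 2 r0) (ler_cabsD _ _))).
rewrite mulrDr cabsM mulrCA.
have E1 := ler_pM (cabs_ge0 _) _ zhr IH.
apply: (@le_trans _ _ (rho * (n%:R ^+ 2 * rho ^+ n * cabs h ^+ 2) +
   n%:R * rho ^+ n.+1 * cabs h ^+ 2)).
  apply: lerD; first by apply: E1; rewrite mulr_ge0 ?cabs_ge0 ?exprn_ge0.
  rewrite cabsM cabsM cabs_nat !cabsX mulrA ler_wpM2r ?exprn_ge0 ?cabs_ge0//.
  case: n {IH E1} => [|n]; first by rewrite !mul0r mulr0.
  rewrite mulrCA ler_wpM2l//= [in leRHS]exprS [in leRHS]exprS expr2 !mulrA.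
  by rewrite ler_wpM2l ?mulr_ge0// lerXn2r ?nnegrE ?cabs_ge0.
have : 0 <= rho ^+ n * cabs h ^+ 2 * rho.
  by rewrite !mulr_ge0 ?exprn_ge0 ?cabs_ge0.
rewrite -natr1 (exprS rho n); have : 0 <= n%:R :> R by [].
move: (n%:R : R) (rho ^+ n) (cabs h ^+ 2) => N P H N0 PH;
  have NPH := mulr_ge0 N0 PH. nra.
Qed.

Let geo_summable_diff c z : geo_coef c -> b * cabs z < 1 ->
  geo_summable (fun n => n%:R * c n * z ^+ n.-1).
Proof.
move=> [M M0 cM] bz1.
have [q0 q1] := andP (bz bz1); set q := b * cabs z in q0 q1 *.
pose t := (q + 1) / 2; have qt : 0 <= q < t by rewrite q0 /t; lra.
have t1 : t < 1 by rewrite /t; lra.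
have t0 : 0 < t by rewrite /t; lra.
apply: (@geo_summableI _ (M * b * (t / (t - q) + 1) / t) t).
- by rewrite divr_ge0 ?(ltW t0)// !mulr_ge0 ?(ltW b0)// addr_ge0//
  divr_ge0 ?subr_ge0//; lra.
- by rewrite (ltW t0).
case=> [|n].
  rewrite mul0r mul0r cabs0 mulr1 divr_ge0 ?(ltW t0)// !mulr_ge0 ?(ltW b0)//.
  by rewrite addr_ge0// divr_ge0 ?subr_ge0//; lra.
rewrite exprS mulrA divfK ?gt_eqF//.
rewrite cabsM cabsM cabs_nat cabsX.
apply: (@le_trans _ _ (M * b * (n.+1%:R * q ^+ n))).
  rewrite exprMn; have := cM n.+1; rewrite exprS => H.
  have -> : M * b * (n.+1%:R * (b ^+ n * cabs z ^+ n)) = n.+1%:R * (M * (b * b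
    ^+ n)) * cabs z ^+ n by ring.
  by rewrite ler_wpM2r ?exprn_ge0 ?cabs_ge0// ler_wpM2l.
rewrite -[leRHS]mulrA ler_wpM2l ?mulr_ge0 ?(ltW b0)//
  -natr1 mulrDl mulrDl lerD ?ler_nXn//.
by rewrite !mul1r lerXn2r ?nnegrE// ltW//; case/andP: qt.
Qed.

(** The second order Taylor errors of the monomials are summed. The ratios
    b |z| < b rho < t < u < 1 leave room for the displacement h, and absorb the
    two factors n. *)
Lemma hol_psum c z : geo_coef c -> b * cabs z < 1 ->
  hol (psum c) z (psum (fun n => n.+1%:R * c n.+1) z).
Proof.
move=> gc bz1; have [M M0 cM] := gc.
pose rho := (cabs z + b^-1) / 2.
have zb : cabs z < b^-1 by rewrite -[b^-1]mul1r ltr_pdivlMr// mulrC.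
have bV0 : 0 < b^-1 by rewrite invr_gt0.
have z0 := cabs_ge0 z.
have zr : cabs z < rho by rewrite /rho; lra.
have rho0 : 0 < rho by rewrite /rho; lra.
have brho : b * rho < 1 by rewrite mulrC -ltr_pdivlMr// mul1r /rho; lra.
have q0 : 0 <= b * rho by rewrite mulr_ge0// ltW.
set q := b * rho in brho q0.
pose t := (q + 1) / 2; pose u := (t + 1) / 2.
have qt : 0 <= q < t by rewrite q0 /t; lra.
have tu : 0 <= t < u by rewrite /u /t; lra.
have u1 : u < 1 by rewrite /u /t; lra.
have u0 : 0 <= u by rewrite /u /t; lra.
pose C := (t / (t - q)) * (u / (u - t)).
have C0 : 0 <= C.
  by case/andP: qt => _ qt; case/andP: tu => t0 tu;
    rewrite /C mulr_ge0// divr_ge0// subr_ge0 ltW.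
exists (2 * (C * M / rho ^+ 2 / (1 - u))), (rho - cabs z); split.
- apply: mulr_ge0 => //; apply: divr_ge0; last by rewrite subr_ge0 ltW.
  by apply: divr_ge0; [exact: mulr_ge0|rewrite exprn_ge0// ltW].
- by rewrite subr_gt0.
move=> h hz; have zhr : cabs (z + h) <= rho.
  by rewrite (le_trans (ler_cabsD _ _))//; lra.
have bzh : b * cabs (z + h) < 1.
  by rewrite (le_lt_trans _ brho)// ler_wpM2l// ltW.
have s1 := geo_summable_psum gc bzh; have s2 := geo_summable_psum gc bz1;
  have s3 := geo_summable_diff gc bz1.
have -> : psum (fun n => n.+1%:R * c n.+1) z = csum (fun n => n%:R * c n * z ^+ n.-1).
  by rewrite [RHS]csum_recl// mul0r mul0r add0r.
have -> : psum c (z + h) - psum c z - csum (fun n => n%:R * c n * z ^+ n.-1) * h =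
    csum (fun n => c n * ((z + h) ^+ n - z ^+ n - n%:R * z ^+ n.-1 * h)).
  transitivity (csum (fun n => (c n * (z + h) ^+ n + (-1) * (c n * z ^+ n))
      + (- h) * (n%:R * c n * z ^+ n.-1))).
    rewrite csumD ?csumD ?csumZ//; try exact: geo_summableZ.
      by rewrite mulN1r mulNr [h * _]mulrC.
    by apply: geo_summableD => //; exact: geo_summableZ.
  by congr csum; apply: funext => n; ring.
apply: le_trans (csum_bound (M := C * M / rho ^+ 2 * cabs h ^+ 2) (q := u) _)
  _; last first.
  by rewrite [leLHS](_ : _ = 2 * (C * M / rho ^+ 2 / (1 - u)) * cabs h ^+ 2)//; ring.
split.
- rewrite mulr_ge0 ?exprn_ge0 ?cabs_ge0//.
  by apply: divr_ge0; [exact: mulr_ge0|rewrite exprn_ge0// ltW].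
- by rewrite u0.
move=> n; rewrite cabsM.
have T := taylor n (ltW zr) zhr.
have nn : n%:R * (n%:R * q ^+ n) <= C * u ^+ n.
  apply: (@le_trans _ _ (t / (t - q) * (n%:R * t ^+ n))).
    by rewrite [leRHS]mulrCA ler_wpM2l// ler_nXn.
  rewrite /C -[leRHS]mulrA ler_wpM2l ?ler_nXn//.
  by case/andP: qt => _ qt; case/andP: tu => t0 _; rewrite divr_ge0// subr_ge0 ltW.
rewrite -(ler_pM2l (exprn_gt0 2 rho0)) mulrCA.
apply: (le_trans (ler_pM (cabs_ge0 _) _ (cM n) T)).
  by rewrite mulr_ge0 ?exprn_ge0 ?cabs_ge0// ltW.
have -> : M * b ^+ n * (n%:R ^+ 2 * rho ^+ n * cabs h ^+ 2) =
   M * cabs h ^+ 2 * (n%:R * (n%:R * q ^+ n)) by rewrite /q [(b * rho) ^+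
     n]exprMn; move: (n%:R : R) => N; ring.
have -> : rho ^+ 2 * (C * M / rho ^+ 2 * cabs h ^+ 2 * u ^+ n) =
   M * cabs h ^+ 2 * (C * u ^+ n) by field; rewrite gt_eqF.
by rewrite ler_wpM2l// mulr_ge0// exprn_ge0// cabs_ge0.
Qed.

End PowerSeries.


(** * Local solutions at a regular singular point *)

Section LocalSolution.
Variables (R : realType) (A : algType R[i]).

(** The finite-rank counterpart of hol on the disk b |z| < 1: one family of
    scalar functions and vectors serves for the whole disk. *)
Definition frhol (b : R) (f f' : R[i] -> A) : Prop :=
  exists (I : finType) (phi phi' : I -> R[i] -> R[i]) (v : I -> A),
  forall z, b * cabs z < 1 ->
  [/\ forall i, hol (phi i) z (phi' i z),
      f z = \sum_i phi i z *: v i & f' z = \sum_i phi' i z *: v i].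

(** The series h with which h(z) z^X solves
      H' = lambda (X / z - beta Y / (1 - beta z) - gamma Z / (1 - gamma z)) H
    near the regular singular point 0. Normalized by h 0 = 1, it involves neither
    logarithms nor branches: they are all in z^X. The poles are at 1 / beta and
    1 / gamma, so that beta = 0 or gamma = 0 sends a pole to infinity. *)
Definition local_sol (b : R) (X Y Z : A) (beta gamma : R[i])
    (h : R[i] -> fps A) : Prop :=
  [/\ forall z, h z 0%N = 1,
      h 0 = 1
    & exists dh : R[i] -> fps A,
      (forall n, frhol b (fun z => h z n) (fun z => dh z n)) /\
      forall z, b * cabs z < 1 ->
        z *: dh z = lam X * h z - h z * lam X
          - (beta * z / (1 - beta * z)) *: (lam Y * h z)
          - (gamma * z / (1 - gamma * z)) *: (lam Z * h z)].

Lemma local_solC b X Y Z beta gamma h :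
  local_sol b X Y Z beta gamma h -> local_sol b X Z Y gamma beta h.
Proof.
move=> [h0 h1 [dh [f e]]]; split=> //; exists dh; split=> // z bz.
by rewrite e// addrAC.
Qed.

Variables (b : R) (X Y Z : A) (beta gamma : R[i]).
Hypotheses (b0 : 0 < b) (bb : cabs beta <= b) (bg : cabs gamma <= b).

(** The primitive of (c(z) - c(0)) / z that vanishes at 0; the convention
    c 0 / 0 = 0 drops the constant term. *)
Definition prim_dlog (c : nat -> R[i]) (n : nat) : R[i] := c n / n%:R.

(** The coefficients of c(z) / (1 - u z). *)
Fixpoint conv_geo (u : R[i]) (c : nat -> R[i]) (n : nat) : R[i] :=
  if n is m.+1 then c m.+1 + u * conv_geo u c m else c 0%N.

(** The primitive of c(z) / (1 - u z) that vanishes at 0. *)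
Definition prim_pole (u : R[i]) (c : nat -> R[i]) (n : nat) : R[i] :=
  if n is m.+1 then conv_geo u c m / m.+1%:R else 0.

Let dps (c : nat -> R[i]) (n : nat) : R[i] := n.+1%:R * c n.+1.

Let natS_neq0 n : n.+1%:R != 0 :> R[i]. Proof. by rewrite pnatr_eq0. Qed.

Lemma geo_coef_prim_dlog c : geo_coef b c -> geo_coef b (prim_dlog c).
Proof.
move=> [M M0 cM]; exists M => // -[|n];
  first by rewrite /prim_dlog invr0 mulr0 cabs0 mulr1.
rewrite /prim_dlog cabsM cabsV cabs_nat.
by rewrite ler_pdivrMr// (le_trans (cM _))//
  ler_peMr ?mulr_ge0 ?exprn_ge0 ?(ltW b0)// ler1n.
Qed.

Lemma prim_dlogP c z : geo_coef b c -> b * cabs z < 1 ->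
  z * psum (dps (prim_dlog c)) z = psum c z - c 0%N.
Proof.
move=> gc bz; rewrite (psum_recl b0 gc bz) [c 0%N + _]addrC addrK; congr (z * _).
congr (psum _ z); apply: funext => n; rewrite /dps /prim_dlog mulrC divfK//.
Qed.

Let conv_geo_bound c u M : 0 <= M -> (forall n, cabs (c n) <= M * b ^+ n) ->
  cabs u <= b -> forall n, cabs (conv_geo u c n) <= n.+1%:R * (M * b ^+ n).
Proof.
move=> M0 cM ub; elim=> [|n IH] /=; first by rewrite mul1r.
rewrite (le_trans (ler_cabsD _ _))// -[n.+2%:R]natr1 mulrDl mul1r addrC lerD ?cM//.
have -> : n.+1%:R * (M * b ^+ n.+1) = b * (n.+1%:R * (M * b ^+ n)) by rewrite
  exprS; ring.
by rewrite cabsM ler_pM ?cabs_ge0.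
Qed.

Lemma geo_coef_prim_pole u c : cabs u <= b -> geo_coef b c ->
  geo_coef b (prim_pole u c).
Proof.
move=> ub [M M0 cM]; exists (M / b); first by rewrite divr_ge0 ?(ltW b0).
case=> [|n] /=; first by rewrite cabs0 mulr1 divr_ge0 ?(ltW b0).
rewrite cabsM cabsV cabs_nat ler_pdivrMr// exprS mulrA divfK ?gt_eqF//.
by rewrite mulrC; exact: conv_geo_bound.
Qed.

(** The coefficients of c(z) / (1 - u z) are O(n b^n) only. They are
    geometrically bounded for a slightly larger b', still with b' |z| < 1, and
    this suffices because the derivative is only evaluated at z. *)
Lemma prim_poleP u c z : cabs u <= b -> geo_coef b c -> b * cabs z < 1 ->
  (1 - u * z) * psum (dps (prim_pole u c)) z = psum c z.
Proof.
move=> ub gc bz.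
have E : dps (prim_pole u c) = conv_geo u c.
  by apply: funext => n; rewrite /dps /= mulrC (divfK (natS_neq0 n)).
have [M M0 cM] := gc; have z0 := cabs_ge0 z.
pose b' := b + (1 - b * cabs z) / (2 * (cabs z + 1)).
have bb' : b < b' by rewrite ltrDl divr_gt0 ?subr_gt0// mulr_gt0// ltr_wpDl.
have b'z : b' * cabs z < 1.
  rewrite /b' mulrDl mulrAC -ltrBrDl ltr_pdivrMr ?mulr_gt0 ?ltr_wpDl//.
  have : 0 < 1 - b * cabs z by rewrite subr_gt0.
  move: (1 - b * cabs z) (cabs z) z0 => s t t0 s0; nra.
have b'0 : 0 < b' := lt_trans b0 bb'.
have ge : geo_coef b' (conv_geo u c).
  exists (M * (b' / (b' - b) + 1)).
    by rewrite mulr_ge0// addr_ge0// divr_ge0 ?subr_ge0// ltW.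
  move=> n; apply: (le_trans (conv_geo_bound M0 cM ub n)).
  rewrite mulrCA -[leRHS]mulrA ler_wpM2l// -natr1 mulrDl [leRHS]mulrDl !mul1r lerD//.
    by rewrite ler_nXn// (ltW b0).
  by rewrite lerXn2r ?nnegrE ?ltW.
have gc' : geo_coef b' c.
  by exists M => // n; rewrite (le_trans (cM n))// ler_wpM2l// lerXn2r ?nnegrE ?ltW.
rewrite E (psum_recl b'0 gc' b'z) mulrBl mul1r {1}(psum_recl b'0 ge b'z) /=.
have -> : psum (fun n => c n.+1 + u * conv_geo u c n) z =
    psum (fun n => c n.+1) z + u * psum (conv_geo u c) z.
  rewrite /psum -csumZ; last exact: (geo_summable_psum b'0 ge b'z).
  rewrite -csumD.
  - by congr csum; apply: funext => n; rewrite mulrDl mulrA.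
  - apply: (geo_summable_psum b'0 _ b'z); have [M' M'0 cM'] := gc'.
    by exists (M' * b'); [rewrite mulr_ge0// ltW|move=> n; rewrite -mulrA -exprS].
  - exact/geo_summableZ/(geo_summable_psum b'0 ge b'z).
ring.
Qed.

(** The coefficient of lambda^(n+1) of h is the primitive of an expression in
    the coefficient of lambda^n. A coefficient is encoded as a list of pairs of a
    power series and a vector; it is their sum. *)
Let step (r : seq ((nat -> R[i]) * A)) : seq ((nat -> R[i]) * A) :=
  [seq (prim_dlog p.1, X * p.2 - p.2 * X) | p <- r] ++
  [seq (prim_pole beta p.1, - (beta *: (Y * p.2))) | p <- r] ++
  [seq (prim_pole gamma p.1, - (gamma *: (Z * p.2))) | p <- r].

Let ev (r : seq ((nat -> R[i]) * A)) z := \sum_(p <- r) psum p.1 z *: p.2.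
Let dev (r : seq ((nat -> R[i]) * A)) z := \sum_(p <- r) psum (dps p.1) z *: p.2.

Let frhol_ev r : {in r, forall p, geo_coef b p.1} -> frhol b (ev r) (dev r).
Proof.
move=> gr; exists 'I_(size r), (fun i => psum (tnth (in_tuple r) i).1),
  (fun i => psum (dps (tnth (in_tuple r) i).1)), (fun i => (tnth (in_tuple r) i).2).
move=> z bz; split.
- by move=> i; apply: (hol_psum b0) => //; apply: gr; exact: mem_tnth.
- by rewrite /ev big_tnth.
- by rewrite /dev big_tnth.
Qed.

Let pole_neq0 u z : cabs u <= b -> b * cabs z < 1 -> 1 - u * z != 0.
Proof.
move=> ub bz; rewrite subr_eq0; apply/eqP => uz.
have := cabs_nat R 1; rewrite mulr1n uz cabsM => E.
have : cabs u * cabs z < 1 by rewrite (le_lt_trans _ bz)// ler_wpM2r// cabs_ge0.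
by rewrite E mulr1n ltxx.
Qed.

(** The term [X, r(0)] / z would produce a logarithm. It vanishes, since the
    constant term r(0) is 1 in degree 0 and 0 afterwards. *)
Let dev_step r z : {in r, forall p, geo_coef b p.1} -> b * cabs z < 1 ->
    ev r 0 = 1 \/ (forall p, p \in r -> p.1 0%N = 0) ->
  z *: dev (step r) z = X * ev r z - ev r z * X
    - (beta * z / (1 - beta * z)) *: (Y * ev r z)
    - (gamma * z / (1 - gamma * z)) *: (Z * ev r z).
Proof.
move=> gr bz r0; rewrite /dev /step !big_cat/= !big_map/= !scalerDr.
have pole u V : cabs u <= b ->
    z *: (\sum_(p <- r) psum (dps (prim_pole u p.1)) z *: - (u *: (V * p.2))) =
    - ((u * z / (1 - u * z)) *: (V * ev r z)).
  move=> ub; rewrite /ev mulr_sumr !scaler_sumr -sumrN big_seq [RHS]big_seq.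
  apply: eq_bigr => p pr; rewrite -scalerAr !scalerA scalerN !scalerA.
  congr (- (_ *: _)); rewrite -(prim_poleP ub (gr p pr) bz).
  by field; exact: pole_neq0.
rewrite (pole beta Y bb) (pole gamma Z bg) addrA.
congr (_ + _ + _).
have -> : z *: (\sum_(p <- r) psum (dps (prim_dlog p.1)) z *: (X * p.2 - p.2 * X)) =
    \sum_(p <- r) (psum p.1 z - p.1 0%N) *: (X * p.2 - p.2 * X).
  rewrite scaler_sumr big_seq [RHS]big_seq; apply: eq_bigr => p pr.
  by rewrite scalerA prim_dlogP//; exact: gr.
have bracket (q : (nat -> R[i]) * A -> R[i]) :
    \sum_(p <- r) q p *: (X * p.2 - p.2 * X) =
    X * (\sum_(p <- r) q p *: p.2) - (\sum_(p <- r) q p *: p.2) * X.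
  rewrite mulr_sumr mulr_suml -sumrB; apply: eq_bigr => p _.
  by rewrite scalerBr -scalerAr -scalerAl.
have -> : \sum_(p <- r) (psum p.1 z - p.1 0%N) *: (X * p.2 - p.2 * X) =
    \sum_(p <- r) psum p.1 z *: (X * p.2 - p.2 * X) -
    \sum_(p <- r) p.1 0%N *: (X * p.2 - p.2 * X).
  by rewrite -sumrB; apply: eq_bigr => p _; rewrite scalerBl.
rewrite bracket [X in _ - X = _](_ : _ = 0) ?subr0// bracket.
have -> : \sum_(p <- r) p.1 0%N *: p.2 = ev r 0.
  by rewrite /ev big_seq [RHS]big_seq; apply: eq_bigr => p pr;
    rewrite (psum0 b0)//; exact: gr.
case: r0 => [->|r0]; first by rewrite mulr1 mul1r subrr.
suff -> : ev r 0 = 0 by rewrite mulr0 mul0r subrr.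
by rewrite /ev big_seq big1// => p pr; rewrite (psum0 b0) ?r0 ?scale0r//; exact: gr.
Qed.

(** All coefficients converge on the same disk, because a primitive of a
    power series converges where the series does. *)
Lemma exists_local_sol : exists h, local_sol b X Y Z beta gamma h.
Proof.
pose r n := iter n step [:: ((fun n => (n == 0%N)%:R), 1)].
have geo0 : geo_coef b (fun n => (n == 0%N)%:R : R[i]).
  exists 1 => // -[|n]; rewrite cabs_nat.
    by rewrite mulr1.
  by rewrite mul1r exprn_ge0// ltW.
have gr n : {in r n, forall p, geo_coef b p.1}.
  elim: n => [|n IH] p; first by rewrite inE => /eqP ->.
  rewrite /= !mem_cat => /orP[/mapP[q qr ->]|/orP[]/mapP[q qr ->]] /=.
  - exact/geo_coef_prim_dlog/IH.
  - exact/geo_coef_prim_pole/IH.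
  - exact/geo_coef_prim_pole/IH.
have r0 n p : p \in r n.+1 -> p.1 0%N = 0.
  rewrite /= !mem_cat => /orP[/mapP[q qr ->]|/orP[]/mapP[q qr ->]] //=.
  by rewrite /prim_dlog invr0 mulr0.
have ev0 z : ev (r 0%N) z = 1.
  rewrite /ev /= big_seq1 /= /psum csum_recl; last first.
    apply: (@geo_summableI _ 1 0); rewrite ?lexx ?ltr01//.
    move=> n; rewrite cabsM cabs_nat cabsX.
    by case: n => [|n]; rewrite ?mulr1// mul0r mul1r exprn_ge0.
  rewrite expr0 mulr1 (_ : (fun n => _) = (fun n : nat => 0 * (0 : R[i]))).
    rewrite csumZ ?mul0r ?addr0 ?scale1r//.
    by apply: (@geo_summableI _ 0 0) => // [|n]; rewrite ?lexx ?ltr01// cabs0 mul0r.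
  by apply: funext => n; rewrite !mul0r.
exists (fun z n => ev (r n) z); split.
- by move=> z; exact: ev0.
- apply: funext => -[|n]; first exact: ev0.
  rewrite /ev fps1E/= big_seq big1// => p pr.
  by rewrite (psum0 b0) ?(r0 n)// ?scale0r//; exact: (gr n.+1).
- exists (fun z n => dev (r n) z); split; first by move=> n; exact/frhol_ev/gr.
  move=> z bz; apply: funext => -[|n]; rewrite !(fpsDE, fpsNE, fpsZE) !lamMl lamMr.
    rewrite !scaler0 !oppr0 !addr0 /dev /= big_seq1 /=.
    rewrite (_ : psum _ _ = 0) ?scale0r ?scaler0// /psum.
    rewrite (_ : (fun n => _) = (fun n : nat => 0 * (0 : R[i]))).
      rewrite csumZ ?mul0r//.
      by apply: (@geo_summableI _ 0 0) => // [|n]; rewrite ?lexx ?ltr01// cabs0 mul0r.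
    by apply: funext => n; rewrite /dps/= mulr0 !mul0r.
  apply: dev_step (gr n) bz _.
  by case: n => [|n]; [left; exact: ev0|right; exact: r0].
Qed.

End LocalSolution.


(** * The complex logarithm along a curve *)

Section ComplexLog.
Variable R : realType.
Implicit Types (p : R -> R[i]) (x : R) (z d u v : R[i]).

Lemma hol_affine u v z : hol (fun w => u + v * w) z v.
Proof.
exists 0, 1; split=> // h _.
by rewrite [X in cabs X](_ : _ = 0) ?cabs0 ?mul0r//; ring.
Qed.

Lemma cderiv_lin u v p x d : cderiv p x d -> cderiv (fun y => u + v * p y) x (v * d).
Proof. by move=> dp; apply: (cderiv_comp dp (hol_affine u v _)). Qed.

Lemma cderiv_real (q : R -> R) x (q' : R) : is_derive x 1 q q' ->
  cderiv (fun y => (q y)%:C) x q'%:C.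
Proof. by move=> dq; split=> //=; exact: is_derive_cst. Qed.

(** The principal branch in the right half-plane, the only region where it
    is used. *)
Definition clog z : R[i] :=
  (ln (complex.Re z ^+ 2 + complex.Im z ^+ 2) / 2) +i*
  atan (complex.Im z / complex.Re z).

Lemma cderiv_clog p x d : cderiv p x d -> 0 < complex.Re (p x) ->
  cderiv (fun y => clog (p y)) x (d / p x).
Proof.
move=> [dRe dIm] Re0; have Re_neq0 : complex.Re (p x) != 0 by rewrite gt_eqF.
have N0 : 0 < complex.Re (p x) ^+ 2 + complex.Im (p x) ^+ 2.
  by rewrite ltr_pwDl ?exprn_gt0// sqr_ge0.
have E : d / p x =
   ((complex.Re d * complex.Re (p x) + complex.Im d * complex.Im (p x)) /
     (complex.Re (p x) ^+ 2 + complex.Im (p x) ^+ 2)) +i*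
   ((complex.Im d * complex.Re (p x) - complex.Re d * complex.Im (p x)) /
     (complex.Re (p x) ^+ 2 + complex.Im (p x) ^+ 2)).
  move: N0; case: (p x) => a b; case: d {dRe dIm} => c e /= N0.
  have N1 := lt0r_neq0 N0.
  have z0 : (a +i* b) != 0.
    apply/eqP => -[a0 b0]; move: N0; by rewrite a0 b0 expr0n/= addr0 ltxx.
  apply: (mulIf z0); rewrite divfK//; apply: complex_eqP; rewrite ?cReM ?cImM/=; field.
    by rewrite N1.
  by rewrite N1.
rewrite E; split => /=.
  have D := is_deriveD (is_deriveX 2 dRe) (is_deriveX 2 dIm).
  have L := is_derive1_ln N0.
  have C := is_deriveZ (2^-1) (@is_derive1_comp _ _
    ((fun y => complex.Re (p y)) ^+ 2 + (fun y => complex.Im (p y)) ^+ 2) x _ _ L D).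
  have F : (fun y => ln (complex.Re (p y) ^+ 2 + complex.Im (p y) ^+ 2) / 2) =
      2^-1 \*: (@ln R \o ((fun y => complex.Re (p y)) ^+ 2 + (fun y =>
        complex.Im (p y)) ^+ 2)).
    by apply: funext => y; rewrite mulrC.
  rewrite F; apply: (is_derive_eq C); rewrite /GRing.scale/= !expr1; field.
  by rewrite gt_eqF.
have Q := is_deriveM dIm (is_deriveV Re_neq0 dRe).
have C := @is_derive1_comp _ atan _ x _ _ (is_derive1_atan _) Q.
apply: (is_derive_eq C); rewrite /GRing.scale/= !fctE; field.
rewrite Re_neq0 gt_eqF//=.
Qed.

End ComplexLog.

(** * Linear differential equations over formal power series *)

Section FpsCalculus.
Variables (R : realType) (A : algType R[i]).
Implicit Types (F G : R -> fps A) (a b : R) (f : fps A) (X Y Z : A).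

Definition fpsderiv a b F F' :=
  forall n, frderiv a b (fun x => F x n) (fun x => F' x n).

Lemma fpsderiv_ext a b F F' G G' :
    {in `[a, b], F =1 G} -> {in `]a, b[, F' =1 G'} ->
  fpsderiv a b F F' -> fpsderiv a b G G'.
Proof.
move=> FG FG' dF n; apply: frderiv_ext (dF n) => x xab; first by rewrite FG.
by rewrite FG'.
Qed.

Lemma fpsderiv_cst a b f : fpsderiv a b (fun=> f) (fun=> 0).
Proof. by move=> n; exact: frderiv_cst. Qed.

Lemma fpsderivB a b F F' G G' : fpsderiv a b F F' -> fpsderiv a b G G' ->
  fpsderiv a b (fun x => F x - G x) (fun x => F' x - G' x).
Proof. by move=> dF dG n; exact: frderivB. Qed.

Lemma fpsderivM a b F F' G G' : fpsderiv a b F F' -> fpsderiv a b G G' ->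
  fpsderiv a b (fun x => F x * G x) (fun x => F' x * G x + F x * G' x).
Proof.
move=> dF dG n.
apply: (@frderiv_ext _ _ _ _ (fun x => \sum_(k < n.+1) F x k * G x (n - k)%N)
  (fun x => \sum_(k < n.+1) (F' x k * G x (n - k)%N + F x k * G' x (n - k)%N))).
- by [].
- by move=> x _; rewrite fpsDE !fpsME -big_split.
- by apply: frderiv_sum => k _; exact: frderivM.
Qed.

Lemma fpsderivMr a b F F' f : fpsderiv a b F F' ->
  fpsderiv a b (fun x => F x * f) (fun x => F' x * f).
Proof.
move=> dF; apply: fpsderiv_ext (fpsderivM dF (fpsderiv_cst a b f)) => x _ //.
by rewrite mulr0 addr0.
Qed.

Lemma fpsderivMl a b F F' f : fpsderiv a b F F' ->
  fpsderiv a b (fun x => f * F x) (fun x => f * F' x).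
Proof.
move=> dF; apply: fpsderiv_ext (fpsderivM (fpsderiv_cst a b f) dF) => x _ //.
by rewrite mul0r add0r.
Qed.

Definition vanish_to n f := forall m, (m < n)%N -> f m = 0.

Lemma vanish_toMl n f g : f 0%N = 0 -> vanish_to n g -> vanish_to n.+1 (f * g).
Proof.
move=> f0 g0 m; rewrite ltnS => mn.
rewrite fpsME big_ord_recl f0 mul0r add0r big1// => i _.
rewrite g0 ?mulr0// (leq_trans _ mn)// ltn_subrL/= (leq_trans _ (ltn_ord i))//.
Qed.

Lemma vanish_toMr n f g : f 0%N = 0 -> vanish_to n g -> vanish_to n.+1 (g * f).
Proof.
move=> f0 g0 m; rewrite ltnS => mn;
  rewrite fpsME big_ord_recr/= subnn f0 mulr0 addr0 big1// => i _.
by rewrite g0 ?mul0r// (leq_trans (ltn_ord i)).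
Qed.

(** Equations of the form D' = lambda (...) determine D' in degree n from D in
    degrees < n, hence only D a = 0 is needed. The derivative is constrained on the
    open interval alone, which allows a singular point of the equation at a. *)
Theorem fpsderiv_unique a b D D' : a <= b -> fpsderiv a b D D' -> D a = 0 ->
    (forall x n, x \in `]a, b[ -> vanish_to n (D x) -> D' x n = 0) ->
  forall x, x \in `[a, b] -> D x = 0.
Proof.
move=> ab dD Da H x xab; apply: funext => n; move: n x xab.
suff : forall n m, (m < n)%N -> forall x, x \in `[a, b] -> D x m = 0.
  by move=> + n x xab => /(_ n.+1 n); exact.
elim=> [//|n IH] m; rewrite ltnS => mn x xab.
have /andP[ax xb] : a <= x <= b by move: xab; rewrite in_itv.
transitivity (D a m); last by rewrite Da.
apply: (frderiv0_cst ax (frderiv_sub (lexx a) xb (dD m))) => y yax.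
have yab : y \in `]a, b[ by apply: (subset_itvW _ _ (lexx a) xb) yax.
apply: H => // k km; apply: IH; first exact: leq_trans mn.
exact: subset_itv_oo_cc.
Qed.

(** In degree n+1, the exponential is t X / (n+1) times its coefficient in
    degree n, so the product rule gives the formula by induction on n. *)
Lemma fpsderiv_exp a b (l l' : R -> R[i]) X :
    {in `[a, b], forall x, cderiv l x (l' x)} ->
  fpsderiv a b (fun x => fps_exp (l x) X)
               (fun x => l' x *: (lam X * fps_exp (l x) X)).
Proof.
move=> dl; have dlX := frderiv_cderiv X dl; elim=> [|n IH].
  apply: frderiv_ext (frderiv_cst a b 1) => x _.
    by rewrite /fps_exp !expr0 fact0 divr1 scale1r.
  by rewrite fpsZE lamMl scaler0.
have natS m : m.+1%:R != 0 :> R[i] by rewrite pnatr_eq0.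
have E t m : m.+1%:R *: fps_exp t X m.+1 = t *: (X * fps_exp t X m).
  rewrite /fps_exp -scalerAr -exprS !scalerA; congr (_ *: _).
  rewrite exprS factS natrM invfM.
  move: (m.+1%:R) (t ^+ m) (m`!%:R^-1) (natS m) => N T f n0.
  by field.
have E' t : fps_exp t X n.+1 = n.+1%:R^-1 *: ((t *: X) * fps_exp t X n).
  by rewrite -scalerAl -E scalerA mulVf// scale1r.
apply: frderiv_ext (frderivZ n.+1%:R^-1 (frderivM dlX IH)) => x _; first by rewrite E'.
rewrite !fpsZE !lamMl -!scalerAl.
case: n {IH E'} => [|n]; first by rewrite scaler0 mulr0 scaler0 addr0 invr1 scale1r.
have -> : l x *: (X * (l' x *: (X * fps_exp (l x) X n))) =
    l' x *: (n.+1%:R *: (X * fps_exp (l x) X n.+1)).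
  rewrite [n.+1%:R *: _]scalerAr E -!scalerAr !scalerA; congr (_ *: _); ring.
rewrite -scalerDr scalerA mulrC -scalerA; congr (_ *: _).
rewrite -[X in X + _]scale1r -scalerDl scalerA.
by rewrite addrC natr1 mulVf// scale1r.
Qed.

End FpsCalculus.


(** * Exponentials *)

Section FpsExp.
Variables (R : realType) (A : algType R[i]).
Implicit Types (s t : R[i]) (X Y : A) (f : fps A).

Lemma fps_exp_0 t X : fps_exp t X 0%N = 1.
Proof. by rewrite /fps_exp !expr0 fact0 divr1 scale1r. Qed.

Lemma fps_exp0 X : fps_exp 0 X = 1.
Proof.
apply: funext => -[|n]; first exact: fps_exp_0.
by rewrite /fps_exp expr0n mul0r scale0r.
Qed.

Lemma fps_expD s t X : fps_exp (s + t) X = fps_exp s X * fps_exp t X.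
Proof.
apply: funext => n; rewrite fpsME /fps_exp addrC exprDn mulr_suml scaler_suml.
apply: eq_bigr => i _; rewrite -scalerAr -scalerAl scalerA -exprD subnKC ?leq_ord//.
congr (_ *: _).
have nz m : (m`!%:R : R[i]) != 0 by rewrite pnatr_eq0 -lt0n fact_gt0.
have E := congr1 (fun m => m%:R : R[i]) (bin_fact (leq_ord i)).
rewrite /= !natrM in E; rewrite -mulr_natr -E.
have : ('C(n, i)%:R : R[i]) != 0.
  by apply/eqP => C0; move: (nz n); rewrite -E C0 mul0r eqxx.
move: ('C(n, i)%:R) (i`!%:R) (nz i) ((n - i)`!%:R) (nz (n - i)%N) => c f f0 g g0 c0.
by field; rewrite f0 g0 c0.
Qed.

Lemma fps_expNK t X : fps_exp (- t) X * fps_exp t X = 1.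
Proof. by rewrite -fps_expD addNr fps_exp0. Qed.

Lemma fps_expKN t X : fps_exp t X * fps_exp (- t) X = 1.
Proof. by rewrite -fps_expD addrN fps_exp0. Qed.

Lemma comm_fps_exp X t f : (forall n, GRing.comm X (f n)) -> GRing.comm f (fps_exp t X).
Proof.
move=> cf; apply: funext => n; rewrite !fpsME [RHS](reindex_inj rev_ord_inj)/=.
apply: eq_bigr => i _; rewrite subSS subKn ?leq_ord// /fps_exp.
by rewrite -scalerAr -scalerAl; congr (_ *: _); exact/commrX/commr_sym.
Qed.

Lemma comm_lam X f : (forall n, GRing.comm X (f n)) -> GRing.comm f (lam X).
Proof. by move=> cf; apply: funext => -[|n]; rewrite lamMl lamMr// cf. Qed.

Lemma fps_exp_comm_lam t X Y : GRing.comm X Y -> GRing.comm (fps_exp t X) (lam Y).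
Proof.
by move=> XY; apply: comm_lam => n; rewrite /fps_exp /GRing.comm -scalerAr -scalerAl;
  congr (_ *: _); exact/commrX/commr_sym.
Qed.

Lemma comm_fps_exp_coef t X Y n : GRing.comm Y X -> GRing.comm Y (fps_exp t X n).
Proof.
move=> YX; rewrite /fps_exp /GRing.comm -scalerAr -scalerAl; congr (_ *: _).
exact: commrX.
Qed.

Lemma fps_exp_comm s t X Y : GRing.comm X Y -> GRing.comm (fps_exp s X) (fps_exp t Y).
Proof. by move=> XY; apply: comm_fps_exp => n; apply: comm_fps_exp_coef;
  exact/commr_sym. Qed.

End FpsExp.

(** * Local solutions along a path *)

Section LocalCalculus.
Variables (R : realType) (A : algType R[i]).
Variables (b : R) (X Y Z : A) (beta gamma : R[i]) (h : R[i] -> fps A).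
Hypothesis (hh : local_sol b X Y Z beta gamma h).

Lemma local_sol_path (a c : R) (p p' : R -> R[i]) :
    {in `[a, c], forall x, cderiv p x (p' x)} ->
    {in `[a, c], forall x, b * cabs (p x) < 1} ->
  exists F' : R -> fps A, fpsderiv a c (fun x => h (p x)) F' /\
    forall x, x \in `]a, c[ -> p x *: F' x =
      p' x *: (lam X * h (p x) - h (p x) * lam X
          - (beta * p x / (1 - beta * p x)) *: (lam Y * h (p x))
          - (gamma * p x / (1 - gamma * p x)) *: (lam Z * h (p x))).
Proof.
move=> dp bp; have [_ _ [dh [fr ode]]] := hh.
exists (fun x => p' x *: dh (p x)); split; last first.
  move=> x xac; have bpx := bp x (subset_itv_oo_cc xac).
  by rewrite -ode// !scalerA mulrC.
move=> n; have [I [phi [phi' [v H]]]] := fr n.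
apply: (@frderiv_ext _ _ _ _ (fun x => \sum_i phi i (p x) *: v i)
  (fun x => \sum_i (phi' i (p x) * p' x) *: v i)).
- by move=> x xac; have [_ -> _] := H _ (bp x xac).
- move=> x xac; rewrite fpsZE; have [_ _ ->] := H _ (bp x (subset_itv_oo_cc xac)).
  by rewrite scaler_sumr; apply: eq_bigr => i _; rewrite scalerA mulrC.
- apply: frderiv_sum => i _; apply: frderiv_cderiv => x xac.
  by apply: cderiv_comp; [exact: dp|have [] := H _ (bp x xac)].
Qed.

(** Both sides of V h = h V solve the same singular equation and agree at 0;
    the path is the segment from 0 to z. *)
Lemma local_sol_comm (V : A) z : b * cabs z < 1 ->
    GRing.comm V X -> GRing.comm V Y -> GRing.comm V Z ->
  forall n, GRing.comm V (h z n).
Proof.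
move=> bz VX VY VZ; have [->|z0] := eqVneq z 0.
  have [_ -> _] := hh; move=> n; rewrite fps1E.
  exact: commr_nat.
pose p (s : R) := 0 + z * s%:C.
have dp : {in `[0, 1], forall x : R, cderiv p x z} by move=> x _; exact: cderiv_affine.
have bp : {in `[0, 1], forall x : R, b * cabs (p x) < 1}.
  move=> x; rewrite in_itv/= => /andP[x0 x1].
  rewrite /p add0r cabsM cabsC ger0_norm// mulrA.
  have [bz0|bz0] := leP 0 (b * cabs z).
    by rewrite (le_lt_trans _ bz)// ler_piMr.
  by rewrite (le_lt_trans _ ltr01)// mulr_le0_ge0// ltW.
have [F' [dF eF]] := local_sol_path dp bp.
pose vc : fps A := fun n => if n == 0%N then V else 0.
have vcMl f n : (vc * f) n = V * f n.
  by rewrite fpsME big_ord_recl subn0 big1 ?addr0// => i _; rewrite mul0r.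
have vcMr f n : (f * vc) n = f n * V.
  rewrite fpsME big_ord_recr/= subnn big1 ?add0r// => i _.
  by rewrite /vc subn_eq0 leqNgt ltn_ord mulr0.
have H := @fpsderiv_unique R A 0 1 _ _ ler01 (fpsderivB (fpsderivMl vc dF)
  (fpsderivMr vc dF)).
have D0 x : x \in `[0, 1] -> vc * h (p x) - h (p x) * vc = 0.
  apply: H.
    have [_ h0 _] := hh.
    by rewrite /p mulr0 addr0 h0 mulr1 mul1r subrr.
  move=> {}x n xab low; rewrite fpsDE fpsNE vcMl vcMr.
  have px0 : p x != 0.
    rewrite /p add0r mulf_neq0//; move: xab; rewrite in_itv/= => /andP[x0 _].
    by apply/eqP => -[xx]; rewrite xx ltxx in x0.
  suff : GRing.comm V (F' x n) by move=> ->; rewrite subrr.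
  have := congr1 (fun f => f n) (eF x xab).
  rewrite fpsZE => /(congr1 (GRing.scale (p x)^-1));
    rewrite scalerA mulVf// scale1r => ->.
  have cZ k (f : A) : GRing.comm V f -> GRing.comm V (k *: f).
    by rewrite /GRing.comm -scalerAr -scalerAl => ->.
  have cB (f g : A) : GRing.comm V f -> GRing.comm V g -> GRing.comm V (f - g).
    by move=> cf cg; apply: commrD => //; exact: commrN.
  apply: (cZ); rewrite fpsZE; apply: (cZ); rewrite !(fpsDE, fpsNE, fpsZE) !lamMl lamMr.
  case: n low => [|n] low.
    by rewrite !scaler0 !subr0; exact: commr0.
  have ch : GRing.comm V (h (p x) n).
    by have := low n (ltnSn n); rewrite fpsDE fpsNE vcMl vcMr => /eqP;
      rewrite subr_eq0 => /eqP.
  do 2?[apply: (cB); last by apply: (cZ); exact: commrM].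
  by apply: (cB); exact: commrM.
move=> n; have /(_ _)/(congr1 (fun f => f n)) := D0 1.
rewrite in_itv/= ler01 lexx => /(_ isT).
by rewrite /p add0r rmorph1 mulr1 fpsDE fpsNE vcMl vcMr => /eqP;
  rewrite subr_eq0 => /eqP.
Qed.

End LocalCalculus.


(** * Primitive sixth roots of unity *)

Section SixthRoot.
Variable R : realType.
Implicit Types (k : R[i]) (x : R).

(** k is exp(i pi / 3) or its conjugate 1 - k. Both occur, for the two ends of an
    arc, and a statement about one applies to the other. *)
Definition prim_sixth_root k := complex.Re k = 1 / 2 /\ complex.Im k ^+ 2 = 3 / 4.

Lemma sixth_conj k : prim_sixth_root k -> prim_sixth_root (1 - k).
Proof.
case: k => a d [/= -> d2]; split => /=; first by lra.
by rewrite add0r sqrrN.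
Qed.

Lemma sixth_sqr k : prim_sixth_root k -> k ^+ 2 = k - 1.
Proof.
case: k => a d [/= -> d2]; apply: complex_eqP; rewrite expr2 ?cReM ?cImM/=; last by lra.
by rewrite expr2 in d2; lra.
Qed.

Lemma Re_1subk k x : prim_sixth_root k -> complex.Re (1 - k * x%:C) = 1 - x / 2.
Proof. by case: k => a d [/= -> d2]; rewrite mulr0 subr0 mulrC mul1r. Qed.

Lemma Im_1subk k x : prim_sixth_root k ->
  complex.Im (1 - k * x%:C) = - (complex.Im k * x).
Proof. by case: k => a d [/= -> d2]; rewrite mulr0 add0r add0r. Qed.

Lemma sqr_cabs_1subk k x : prim_sixth_root k ->
  cabs (1 - k * x%:C) ^+ 2 = 1 - x + x ^+ 2.
Proof.
move=> sk; rewrite sqr_cabs Re_1subk// Im_1subk// sqrrN exprMn.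
by have [_ ->] := sk; field.
Qed.

Lemma clog1 : clog 1 = 0 :> R[i].
Proof.
by rewrite /clog /= expr1n expr0n addr0 ln1 !mul0r atan0.
Qed.

Lemma cderiv_1subk k x : cderiv (fun y => 1 - k * y%:C) x (- k).
Proof.
have -> : (fun y : R => 1 - k * y%:C) = (fun y => 1 + (- k) * y%:C).
  by apply: funext => y; rewrite mulNr.
exact: cderiv_affine.
Qed.

Lemma sixth_neq0 k : prim_sixth_root k -> k != 0.
Proof. by move=> [rk _]; apply/eqP => E; move: rk; rewrite E/=; lra. Qed.

Lemma sub_sixth_neq0 k x : prim_sixth_root k -> x%:C - k != 0.
Proof.
move=> [_]; case: k => a d /= d2; apply/eqP => /(congr1 (@complex.Im R)) /=.
by rewrite sub0r => /eqP; rewrite oppr_eq0 => /eqP E; move: d2; rewrite E expr0n/=; lra.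
Qed.

(** 1 / (2 - k) and 1 / (1 + k) are (1 + k) / 3 and (2 - k) / 3: these are the
    parameters beta and gamma that place the poles at 1 - k^2 = 2 - k and
    1 - k^4 = 1 + k, the other two cube roots of unity seen in the coordinate
    1 - w. *)
Lemma sixth_pole_unit k : prim_sixth_root k -> (1 + k) / 3 * (2 - k) = 1.
Proof. by move=> /sixth_sqr k2; field: k2. Qed.

End SixthRoot.

(** * From the origin to an arc midpoint *)

Section Transition.
Variables (R : realType) (A : algType R[i]).
Implicit Types (X Y Z : A) (k : R[i]).

(** Multiplying h by z^X absorbs the commutator of the singular equation and
    leaves an ordinary linear equation away from z = 0. The logarithm is chosen
    along the path, by its derivative. *)
Lemma local_sol_transport (b : R) X Y Z beta gamma h (a c : R) (p p' l : R -> R[i]) :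
    local_sol b X Y Z beta gamma h ->
    {in `[a, c], forall x, cderiv p x (p' x)} ->
    {in `[a, c], forall x, b * cabs (p x) < 1} ->
    {in `[a, c], forall x, p x != 0} ->
    {in `[a, c], forall x, cderiv l x (p' x / p x)} ->
  exists G', fpsderiv a c (fun x => h (p x) * fps_exp (l x) X) G' /\
    forall x, x \in `]a, c[ -> G' x =
      ((p' x / p x) *: lam X - (beta * p' x / (1 - beta * p x)) *: lam Y
        - (gamma * p' x / (1 - gamma * p x)) *: lam Z)
      * (h (p x) * fps_exp (l x) X).
Proof.
move=> hh dp bp p0 dl; have [F' [dF eF]] := local_sol_path hh dp bp.
have dG := fpsderivM dF (fpsderiv_exp X dl).
exists (fun x => F' x * fps_exp (l x) X +
                 h (p x) * ((p' x / p x) *: (lam X * fps_exp (l x) X))).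
split=> // x xac; have px0 := p0 x (subset_itv_oo_cc xac).
have -> : F' x = (p x)^-1 *: (p x *: F' x) by rewrite scalerA mulVf// scale1r.
rewrite eF// !scalerA (mulrC _ (p' x)).
move: (h (p x)) (fps_exp (l x) X) => H E.
rewrite -[H * (_ *: _)]scalerAr [H * (lam X * E)]mulrA [X in _ + X]scalerAl
  -mulrDl mulrA.
congr (_ * E); rewrite !mulrBl -!scalerAl !scalerBr !scalerA.
set u := p' x / p x.
have -> : u * (beta * p x / (1 - beta * p x)) = beta * p' x / (1 - beta * p x).
  by rewrite /u; move: (1 - beta * p x)^-1 => v; field.
have -> : u * (gamma * p x / (1 - gamma * p x)) = gamma * p' x / (1 - gamma * p x).
  by rewrite /u; move: (1 - gamma * p x)^-1 => v; field.
by rewrite addrAC [X in X - _]addrAC subrK.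
Qed.

Variables (k : R[i]) (sk : prim_sixth_root k).
Let b : R := 2 / 3.

(** On the segment from w = 0 to w = k, the coordinate 1 - w stays in the disk
    of the local solution and in the right half-plane. *)
Lemma path_1subk x : x \in `[0, 1] ->
  [/\ b * cabs (1 - k * x%:C) < 1, 0 < complex.Re (1 - k * x%:C) & 1 - k * x%:C != 0].
Proof.
rewrite in_itv/= => /andP[x0 x1].
have Re0 : 0 < complex.Re (1 - k * x%:C) by rewrite Re_1subk//; lra.
split=> //; last by apply/eqP => E; rewrite E ltxx in Re0.
have c1 : cabs (1 - k * x%:C) <= 1.
  rewrite -(@ler_pXn2r _ 2) ?nnegrE ?cabs_ge0// expr1n sqr_cabs_1subk//; nra.
have := cabs_ge0 (1 - k * x%:C); rewrite /b; lra.
Qed.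

Lemma cderiv_clog_1subk x : x \in `[0, 1] ->
  cderiv (fun y => clog (1 - k * y%:C)) x (- k / (1 - k * x%:C)).
Proof.
by move=> x01; apply: cderiv_clog (cderiv_1subk k x) _; have [] := path_1subk x01.
Qed.

End Transition.

Section TransitionTheorem.
Variables (R : realType) (A : algType R[i]) (k : R[i]) (sk : prim_sixth_root k).
Let b : R := 2 / 3.
Let k2 : k ^+ 2 = k - 1. Proof. exact: sixth_sqr. Qed.
Let sk' := sixth_conj sk.

(** The solutions based at w = 1 and at w = k^2 solve the same equation. They
    are related by K at w = 0, where both coordinates are 1, hence all along the
    segment w = k x, which ends at the midpoint of the arc from 1 to k^2. There
    the coordinates are 1 - k and 1 - k / k^2 = k. *)
Theorem transition (X Y Z : A) (hX hY : R[i] -> fps A) (K : fps A) :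
    local_sol b X Y Z ((1 + k) / 3) ((2 - k) / 3) hX ->
    local_sol b Y Z X ((1 + k) / 3) ((2 - k) / 3) hY ->
    hX 1 = hY 1 * K ->
  hX (1 - k) * fps_exp (clog (1 - k)) X = hY k * fps_exp (clog k) Y * K.
Proof.
move=> solX solY XY.
have k0 := sixth_neq0 sk.
have dp (k' : R[i]) : {in `[0, 1], forall x : R,
  cderiv (fun y => 1 - k' * y%:C) x (- k')}.
  by move=> x _; exact: cderiv_1subk.
have bp k' : prim_sixth_root k' ->
  {in `[0, 1], forall x : R, b * cabs (1 - k' * x%:C) < 1}.
  by move=> s x /(path_1subk s)[].
have p0 k' : prim_sixth_root k' -> {in `[0, 1], forall x : R, (1 - k' * x%:C) != 0}.
  by move=> s x /(path_1subk s)[].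
have dl k' : prim_sixth_root k' -> {in `[0, 1], forall x : R,
    cderiv (fun y => clog (1 - k' * y%:C)) x (- k' / (1 - k' * x%:C))}.
  by move=> s x; exact: cderiv_clog_1subk.
have [F [dF eF]] := local_sol_transport solX (dp k) (bp _ sk) (p0 _ sk) (dl _ sk).
have [G [dG eG]] := local_sol_transport solY (dp _) (bp _ sk') (p0 _ sk') (dl _ sk').
have := fpsderiv_unique ler01 (fpsderivB dF (fpsderivMr K dG)).
rewrite !mulr0 !subr0 clog1 !fps_exp0 !mulr1 -XY subrr => /(_ erefl) H.
suff /H/(_ 1) : forall (x : R) n, x \in `]0, 1[ ->
    vanish_to n (hX (1 - k * x%:C) * fps_exp (clog (1 - k * x%:C)) X -
      hY (1 - (1 - k) * x%:C) * fps_exp (clog (1 - (1 - k) * x%:C)) Y * K) ->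
    (F x - G x * K) n = 0.
  rewrite in_itv/= ler01 lexx => /(_ isT)/eqP.
  by rewrite subr_eq0 rmorph1 !mulr1 subKr => /eqP.
move=> x n x01 low; have x01' := subset_itv_oo_cc x01.
rewrite eF// eG//.
have p1 := p0 _ sk x x01'; have p2 := p0 _ sk' x x01'.
have x1 : 1 + x%:C != 0 :> R[i].
  apply/eqP => /(congr1 (@complex.Re R))/=; move: x01';
    rewrite in_itv/= => /andP[? _]; lra.
have xk := sub_sixth_neq0 x sk; have xk' := sub_sixth_neq0 x sk'.
have simp (u v w : R[i]) : u != 0 -> w != 0 -> v = u * w -> u / v = w^-1.
  by move=> u0 w0 ->; field; rewrite w0 u0.
have k'0 := sixth_neq0 sk'.
have bg : (1 + k) / 3 * (2 - k) = 1 := sixth_pole_unit sk.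
have bk0 : 1 + k != 0.
  by apply/eqP => E; move/eqP: bg; rewrite E !mul0r eq_sym oner_eq0.
have gk0 : 2 - k != 0.
  by apply/eqP => E; move/eqP: bg; rewrite E mulr0 eq_sym oner_eq0.
set w1 := (X in X * _ - _); set w2 := (X in _ - X * _ * _).
(* both are the pull-back along w = k x of the connection with residues X, Y and
     Z at 1, k^2 and k^4 *)
have -> : w2 = w1.
  rewrite /w1 /w2.
  rewrite (simp (- k) _ (x%:C - (1 - k))) ?oppr_eq0//; last by ring: k2.
  rewrite (simp (- (1 - k)) _ (x%:C - k)) ?oppr_eq0//; last by ring: k2.
  rewrite (simp ((1 + k) / 3 * - k) _ (- (x%:C - k))) ?mulf_neq0 ?oppr_eq0//;
    last by field: k2.
  rewrite (simp ((2 - k) / 3 * - k) _ (- (1 + x%:C))) ?mulf_neq0 ?oppr_eq0//;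
    last by field: k2.
  rewrite (simp ((1 + k) / 3 * - (1 - k)) _ (- (1 + x%:C))) ?mulf_neq0
    ?oppr_eq0//; last by field: k2.
  rewrite (simp ((2 - k) / 3 * - (1 - k)) _ (- (x%:C - (1 - k)))) ?mulf_neq0
    ?oppr_eq0//; last by field: k2.
  move: (x%:C - (1 - k)) (x%:C - k) (1 + x%:C) (lam X) (lam Y) (lam Z) => u v t U V W.
  by rewrite !invrN !scaleNr !opprK [LHS]addrC addrA.
rewrite -mulrA -mulrBr; apply: (vanish_toMl _ low) => //.
by rewrite /w1 !(fpsDE, fpsNE, fpsZE) /lam/= !scaler0 !subr0.
Qed.
End TransitionTheorem.


(** * From the three cube roots of unity to the unit interval *)

Lemma mobius_bracket (R : realType) (V : lmodType R[i]) (T1 T2 T3 T4 : V) (m r : R[i]) :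
  (1 + m) *: (T1 - T2) - (r - m) *: T3 - (- m) *: T4 + m *: T2 =
  T1 - r *: T3 + m *: (T1 + T3 + T4) - T2.
Proof.
rewrite scalerDl scale1r !scalerBr !scalerBl !scalerDr scaleNr opprK opprB.
by rewrite !addrA [LHS](ACl (1*6*3*5*7*2*(4*8)))/= addNr addr0.
Qed.

Section Comparison.
Variables (R : realType) (A : algType R[i]) (k : R[i]) (sk : prim_sixth_root k).
Let b : R := 2 / 3.
Let k2 : k ^+ 2 = k - 1. Proof. exact: sixth_sqr. Qed.
Let c : R[i] := (1 - 2 * k) / k.
Let p (x : R) : R[i] := - c + c * (1 - k * x%:C)^-1.
Let p' (x : R) : R[i] := (1 - 2 * k) / (1 - k * x%:C) ^+ 2.

Let q0 (x : R) : x \in `[0, 1 / 2] -> 1 - k * x%:C != 0.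
Proof.
rewrite in_itv/= => /andP[x0 x1]; have [] := @path_1subk _ k sk x => //.
by rewrite in_itv/= x0/=; lra.
Qed.

Let pE (x : R) : x \in `[0, 1 / 2] -> p x = (1 - 2 * k) * x%:C / (1 - k * x%:C).
Proof.
by move=> /q0 xq; rewrite /p /c; have k0 := sixth_neq0 sk; field; rewrite k0 xq.
Qed.

Let dp (x : R) : x \in `[0, 1 / 2] -> cderiv p x (p' x).
Proof.
move=> /q0 xq; have k0 := sixth_neq0 sk.
have := cderiv_lin (- c) c (cderiv_comp (cderiv_1subk k x) (hol_inv xq)).
by move=> /cderiv_eq; apply; rewrite /p' /c; field; rewrite k0 xq.
Qed.

Let bp (x : R) : x \in `[0, 1 / 2] -> b * cabs (p x) < 1.
Proof.
move=> x01; rewrite pE//; have xq := q0 x01.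
move: x01; rewrite in_itv/= => /andP[x0 x1].
have c1 : cabs ((1 - 2 * k) * x%:C / (1 - k * x%:C)) <= 1.
  rewrite -(@ler_pXn2r _ 2) ?nnegrE ?cabs_ge0// expr1n !cabsM cabsV !exprMn exprVn.
  rewrite ler_pdivrMr; last by rewrite exprn_gt0//
    lt_neqAle eq_sym cabs_eq0 xq cabs_ge0.
  rewrite sqr_cabs_1subk// cabsC real_normK ?num_real// mul1r.
  have -> : cabs (1 - 2 * k) ^+ 2 = 3.
    rewrite sqr_cabs; move: sk; case: (k) => r d [/= -> d2].
    move: d2; rewrite !expr2 => d2. nra.
  nra.
have := cabs_ge0 ((1 - 2 * k) * x%:C / (1 - k * x%:C)); rewrite /b; lra.
Qed.

(** The homography t = (1 - 2 k) x / (1 - k x) sends 0, 1 and infinity to the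
    positions 0, 2 - k and 1 + k of the residues X, Y and Z. In the variable x, the
    connection of h is therefore the one on the unit interval, with X at 0 and Y
    at 1, plus the residue - (X + Y + Z) at x = 1 / k, that is at t = infinity.
    This last residue is central and only contributes a power of 1 - k x; the other
    power comes from t^X. Both sides of the equality, with x in the place of 1/2,
    solve the same equation, singular at 0, and are 1 at 0. The end x = 1/2 is the
    arc midpoint t = 1 - k. *)
Theorem comparison (X Y Z W : A) (h g : R[i] -> fps A) :
    GRing.comm (X + Y + Z) X -> GRing.comm (X + Y + Z) Y -> GRing.comm (X + Y + Z) W ->
    local_sol b X Y Z ((1 + k) / 3) ((2 - k) / 3) h ->
    local_sol 1 X Y W 1 0 g ->
  h (1 - k) * fps_exp (- clog (1 - k / 2)) X =
  g (1 / 2) * fps_exp (- clog (1 - k / 2)) (X + Y + Z).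
Proof.
set L := X + Y + Z => LX LY LW solh solg.
have half0 : 0 <= 1 / 2 :> R by lra.
have id_path : {in `[0, 1 / 2], forall x : R, cderiv (fun y => y%:C) x 1}.
  by move=> x _; apply: cderiv_real; exact: is_derive_id.
have bid : {in `[0, 1 / 2], forall x : R, 1 * cabs x%:C < 1}.
  by move=> x; rewrite in_itv/= => /andP[x0 x1]; rewrite cabsC ger0_norm// mul1r; lra.
have [F [dF eF]] := local_sol_path solh dp bp.
have [G [dG eG]] := local_sol_path solg id_path bid.
pose l (x : R) := - clog (1 - k * x%:C).
pose l' (x : R) := k / (1 - k * x%:C).
have dl : {in `[0, 1 / 2], forall x : R, cderiv l x (l' x)}.
  move=> x; rewrite in_itv/= => /andP[x0 x1].
  have x01 : x \in `[0, 1] by rewrite in_itv/= x0/=; lra.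
  have := cderiv_lin 0 (-1) (cderiv_clog_1subk sk x01).
  rewrite (_ : (fun y => _) = l); last first.
    by apply: funext => y; rewrite add0r mulN1r.
  by move=> /cderiv_eq; apply; rewrite /l' mulN1r mulNr opprK.
have gL (x : R) : x \in `[0, 1 / 2] -> g x%:C * lam L = lam L * g x%:C.
  move=> x01; apply: comm_lam.
  by apply: (local_sol_comm solg (bid _ x01)) => //.
have H := fpsderiv_unique half0 (fpsderivB (fpsderivM dF (fpsderiv_exp X dl))
  (fpsderivM dG (fpsderiv_exp L dl))).
have [_ h0 _] := solh; have [_ g0 _] := solg.
have l0 : l 0 = 0 by rewrite /l rmorph0 mulr0 subr0 clog1 oppr0.
have p0 : p 0 = 0 by rewrite /p rmorph0 mulr0 subr0 invr1 mulr1 addNr.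
move: H; rewrite p0 l0 !fps_exp0 !mulr1 rmorph0 h0 g0 subrr => /(_ erefl) H.
have kx2 : k / 2 = k * (1 / 2)%:C by rewrite rmorphM rmorph1 mul1r fmorphV rmorph_nat.
have h12 : (1 / 2 : R) \in `[0, 1 / 2] by rewrite in_itv/= half0 lexx.
have p12 : p (1 / 2) = 1 - k.
  rewrite pE//; apply: (canLR (mulfK (q0 h12))).
  by rewrite rmorphM rmorph1 fmorphV rmorph_nat mul1r; field: k2.
suff /H/(_ _ h12) : forall (x : R) n, x \in `]0, 1 / 2[ ->
   vanish_to n (h (p x) * fps_exp (l x) X - g x%:C * fps_exp (l x) L) ->
   (F x * fps_exp (l x) X + h (p x) * (l' x *: (lam X * fps_exp (l x) X)) -
   (G x * fps_exp (l x) L + g x%:C * (l' x *: (lam L * fps_exp (l x) L)))) n = 0.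
  rewrite p12 /l -kx2 => /eqP; rewrite subr_eq0 => /eqP ->.
  by rewrite rmorphM rmorph1 fmorphV rmorph_nat.
move=> x n x01 low; have x01' := subset_itv_oo_cc x01.
have x0 : x%:C != 0 :> R[i].
  move: x01; rewrite in_itv/= => /andP[x_gt0 _].
  by apply/eqP => -[x0]; rewrite x0 ltxx in x_gt0.
have xq := q0 x01'.
have x1 : 1 - x%:C != 0 :> R[i].
  apply/eqP => /(congr1 (@complex.Re R))/= x1.
  by move: x01'; rewrite in_itv/= => /andP[_ x2]; lra.
have k3 : 1 - 2 * k != 0.
  apply/eqP => k12; have : (1 - 2 * k) ^+ 2 = - 3 by ring: k2.
  by rewrite k12 expr0n/= => /esym/eqP; rewrite oppr_eq0 pnatr_eq0.
have px : p x != 0 by rewrite pE// !mulf_neq0// invr_neq0.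
pose m := k * x%:C / (1 - k * x%:C); pose r := x%:C / (1 - x%:C).
pose w := lam X - r *: lam Y + m *: lam L.
suff key : x%:C *: (F x * fps_exp (l x) X + h (p x) * (l' x *: (lam X * fps_exp
  (l x) X)) -
   (G x * fps_exp (l x) L + g x%:C * (l' x *: (lam L * fps_exp (l x) L)))) =
   w * (h (p x) * fps_exp (l x) X - g x%:C * fps_exp (l x) L) -
   (h (p x) * fps_exp (l x) X - g x%:C * fps_exp (l x) L) * lam X.
  apply: (scalerI x0); rewrite scaler0 -fpsZE key fpsDE fpsNE.
  rewrite (vanish_toMl _ low)// ?(vanish_toMr _ low)// ?subrr//.
  by rewrite /w !(fpsDE, fpsNE, fpsZE) /lam/= !scaler0 subr0 addr0.
have xF : x%:C *: F x = (1 + m) *: (lam X * h (p x) - h (p x) * lam X) -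
   (r - m) *: (lam Y * h (p x)) - (- m) *: (lam Z * h (p x)).
  have -> : x%:C *: F x = (x%:C / p x) *: (p x *: F x) by rewrite scalerA divfK.
  have betap : (1 + k) / 3 * p x = (1 - k) * x%:C / (1 - k * x%:C).
    by rewrite pE//; field: k2; rewrite xq.
  have gammap : (2 - k) / 3 * p x = - m.
    by rewrite pE// /m; field: k2; rewrite xq.
  have u1 : x%:C / p x * p' x = 1 + m.
    by rewrite pE// /p' /m; field; rewrite xq x0 k3.
  have one_m : 1 + m != 0 by rewrite /m (_ : _ + _ = (1 - k * x%:C)^-1)
    ?invr_neq0//; field.
  have u2 : (1 + m) * ((1 - k) * x%:C / (1 - k * x%:C) / (1 - (1 - k) * x%:C /
    (1 - k * x%:C))) = r - m.
    rewrite (_ : 1 - _ = (1 - x%:C) / (1 - k * x%:C)); last by field.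
    by rewrite /m /r; field; rewrite x1 xq.
  rewrite eF// betap gammap scalerA u1 !scalerBr !scalerA u2 opprK.
  by rewrite [(1 + m) * _]mulrC divfK.
have xG : x%:C *: G x = lam X * g x%:C - g x%:C * lam X - r *: (lam Y * g x%:C).
  by rewrite eG// scale1r !mul1r !mul0r scale0r subr0.
have xl : x%:C * l' x = m by rewrite /m /l'; field.
have EX := fps_exp_comm_lam (l x) (commr_refl X).
have EL := fps_exp_comm_lam (l x) LX.
have gLx := gL x x01'.
move: (h (p x)) (g x%:C) (fps_exp (l x) X) (fps_exp (l x) L) (F x) (G x) xF xG
  EX EL gLx {low}
  => H0 g1 E E' F0 G0 xF xG EX EL gLx.
have keyL : x%:C *: (F0 * E + H0 * (l' x *: (lam X * E))) =
    w * (H0 * E) - H0 * E * lam X.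
  rewrite scalerDr scalerAl xF -[H0 * (_ *: _)]scalerAr scalerA xl.
  rewrite !mulrBl -!scalerAl mulrBl -!mulrA mobius_bracket /w.
  by rewrite mulrDl mulrBl -!scalerAl /L !lamD !mulrDl EX.
have keyR : x%:C *: (G0 * E' + g1 * (l' x *: (lam L * E'))) =
    w * (g1 * E') - g1 * E' * lam X.
  rewrite scalerDr scalerAl xG -[g1 * (_ *: _)]scalerAr scalerA xl.
  rewrite !mulrBl -!scalerAl [g1 * (lam L * E')]mulrA gLx -!mulrA /w.
  by rewrite mulrDl mulrBl -!scalerAl EL [LHS](ACl (1*3*4*2)).
by rewrite scalerBr keyL keyR mulrBr mulrBl !opprB [LHS](AC (2*2) ((1*4)*(3*2))).
Qed.

End Comparison.


(** * The equation of the parallel transport *)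

Section Transport.
Variables (R : realType) (A : algType R[i]) (X Y : A).
Variables (d b : R).
Hypotheses (d0 : 0 < d) (db : d < b) (b1 : b < 1).

Let kern (i : bool) (s : seq bool) (u : R) := (u - i%:R)^-1 * iterated_int d s u.

Let kern_continuous i s : {within `[d, b], continuous (iterated_int d s)} ->
  {within `[d, b], continuous (kern i s)}.
Proof.
move=> cs; have cK : {within `[d, b], continuous (fun u : R => (u - i%:R)^-1)}.
  apply: continuous_in_subspaceT => x; rewrite inE/= in_itv/= => /andP[dx xb].
  have xi : x - i%:R != 0.
    by rewrite subr_eq0; case: i;
      [rewrite lt_eqF// (le_lt_trans xb)|rewrite gt_eqF// (lt_le_trans d0)].
  apply: cvgV => //.
  by apply: cvgB; [exact: cvg_id|exact: cvg_cst].
by move=> x; apply: cvgM; [exact: cK|exact: cs].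
Qed.

(** The bounds d and b keep the integrands away from their poles 0 and 1. *)
Lemma iterated_int_continuous s : {within `[d, b], continuous (iterated_int d s)}.
Proof.
elim: s => [|i s IH] /=; first by apply: continuous_subspaceT; exact: cst_continuous.
apply: (@parameterized_integral_continuous R d b (kern i s)); first exact: ltW.
apply: continuous_compact_integrable; first exact: segment_compact.
exact: kern_continuous.
Qed.

Lemma is_derive_iterated_int i s x : x \in `]d, b[ ->
  is_derive x 1 (iterated_int d (i :: s)) ((x - i%:R)^-1 * iterated_int d s x).
Proof.
move=> xdb; have ck := @kern_continuous i s (@iterated_int_continuous s).
have /andP[dx xb] : d < x < b by move: xdb; rewrite in_itv.
have cx : {for x, continuous (kern i s)}.
  by have /(continuous_within_itvP _ db)[+ _ _] := ck; apply.
have int : (@lebesgue_measure R).-integrable `[d, b] (EFin \o kern i s).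
  by apply: continuous_compact_integrable => //; exact: segment_compact.
have [dF F'] := continuous_FTC1_closed xb int dx cx.
by split; [exact: dF|rewrite -derive1E; exact: F'].
Qed.

Definition transport_to (x : R) : fps A :=
  fun r => \sum_(s : r.-tuple bool)
    (iterated_int d s x)%:C *: \prod_(i <- s) (if i then Y else X).

Let sum_tuple_cons (V : nmodType) n (f : seq bool -> V) :
  \sum_(s : n.+1.-tuple bool) f s =
  \sum_(s : n.-tuple bool) f (true :: s) + \sum_(s : n.-tuple bool) f (false :: s).
Proof.
rewrite (reindex (fun p : bool * n.-tuple bool => [tuple of p.1 :: p.2])) /=;
  last first.
  exists (fun s : n.+1.-tuple bool => (thead s, [tuple of behead s])) => /= s _.
    by case: s => i s; congr (_, _); apply: val_inj.
  by rewrite -tuple_eta.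
rewrite -(pair_big xpredT xpredT (fun i (s : n.-tuple bool) => f (i :: s)))/=.
by rewrite big_bool.
Qed.

Lemma transport_to_deriv : exists T', fpsderiv d b transport_to T' /\
  forall x, x \in `]d, b[ ->
    T' x = (x%:C^-1 *: lam X - (1 - x%:C)^-1 *: lam Y) * transport_to x.
Proof.
pose dI (s : seq bool) (x : R) :=
  if s is i :: s' then (x - i%:R)^-1 * iterated_int d s' x else 0.
exists (fun x r => \sum_(s : r.-tuple bool) (dI s x)%:C *: \prod_(i <- s) (if i
  then Y else X)).
split.
  move=> n; apply: frderiv_sum => s _; apply: frderiv1.
    exact: iterated_int_continuous.
  case: s => -[|i s] ss x xdb; first exact: is_derive_cst.
  exact: is_derive_iterated_int.
move=> x xdb; apply: funext => -[|n].
  rewrite mulrBl fpsDE fpsNE -!scalerAl !fpsZE !lamMl !scaler0 subrr.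
  by rewrite big1// => s _; rewrite tuple0 /= scale0r.
rewrite mulrBl fpsDE fpsNE -!scalerAl !fpsZE !lamMl.
rewrite (sum_tuple_cons n (fun s => (dI s x)%:C *: \prod_(i <- s) (if i then Y
  else X))).
rewrite /transport_to !mulr_sumr !scaler_sumr addrC -sumrN; congr (_ + _);
  apply: eq_bigr => s _; rewrite /= big_cons/= -scalerAr !scalerA.
  by rewrite subr0 rmorphM fmorphV.
rewrite -scaleNr rmorphM fmorphV rmorphB rmorph1 -mulNr -invrN opprB.
by [].
Qed.

Lemma transport_to_start : transport_to d = 1.
Proof.
have I0 i s : iterated_int d (i :: s) d = 0.
  by rewrite /= set_itv1 Rintegral_set1.
apply: funext => -[|n]; rewrite /transport_to fps1E.
  rewrite (eq_bigr (fun=> 1)); last first.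
    by move=> s _; rewrite tuple0 /= big_nil scale1r.
  by rewrite big_const card_tuple expn0 /= addr0.
by rewrite big1// => -[[|i s]//= ss] _;
  rewrite -/(iterated_int d (i :: s) d) I0 scale0r.
Qed.

End Transport.


(** * Limits of finite-rank functions *)

Section FiniteRankLimits.
Variables (R : realType).

(** The finite-rank counterpart of a limit: it implies convergence for every
    norm, by frlim_norm, and it is compatible with products, which norms of A
    need not be. *)
Definition frlim (V : lmodType R[i]) (T : Type) (F : set_system T) (f : T ->
  V) (L : V) :=
  exists (I : finType) (phi : I -> T -> R) (l : I -> R) (v : I -> V),
  [/\ forall i, phi i p @[p --> F] --> l i,
      \forall p \near F, f p = \sum_i (phi i p)%:C *: v i
    & L = \sum_i (l i)%:C *: v i].

Section Module.
Variables (V : lmodType R[i]) (T : Type) (F : set_system T).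
Context {FF : Filter F}.
Implicit Types (f g : T -> V) (L : V).

Lemma is_norm_sum (N : V -> R) (I : finType) (v : I -> V) : is_norm N ->
  N (\sum_i v i) <= \sum_i N (v i).
Proof.
move=> [N0 _ ND NZ]; elim/big_ind2: _ => [|x r y s xr ys|//].
- by have := NZ 0 0; rewrite scale0r cabsE cabs0 mul0r => -[->].
- by rewrite (le_trans (ND _ _))// lerD.
Qed.

Lemma is_normZ (N : V -> R) (r : R) x : is_norm N -> N (r%:C *: x) = `|r| * N x.
Proof. by move=> [_ _ _ NZ]; apply: complexI; rewrite NZ cabsE cabsC rmorphM. Qed.

Lemma frlim_norm f L (N : V -> R) : is_norm N -> frlim F f L ->
  N (f p - L) @[p --> F] --> (0 : R).
Proof.
move=> nN [I [phi [l [v [cphi fE LE]]]]].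
have c0 : (\sum_i `|phi i p - l i| * N (v i)) @[p --> F] --> (0 : R).
  rewrite [X in _ --> X](_ : _ = \sum_(i : I) (0 : R)); last by rewrite big1.
  apply: (@cvg_big R I +%R 0 xpredT _ T F) => [|i _]; first exact: add_continuous.
  rewrite -(mul0r (N (v i))); apply: cvgMr_tmp.
  rewrite -(normr0 R); apply: cvg_norm; rewrite -(subrr (l i)).
  by apply: cvgB; [exact: cphi|exact: cvg_cst].
apply: (squeeze_cvgr _ (cvg_cst 0) c0).
apply: filterS fE => p ->; have [N0 _ _ _] := nN; rewrite N0 /= LE -sumrB.
rewrite (le_trans (is_norm_sum _ nN))// ler_sum// => i _.
by rewrite -scalerBl -rmorphB is_normZ.
Qed.

Lemma frlim_ext f g L : (\forall p \near F, f p = g p) -> frlim F f L -> frlim F g L.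
Proof.
move=> fg [I [phi [l [v [cphi fE LE]]]]]; exists I, phi, l, v; split=> //.
by apply: filterS2 fg fE => p <-.
Qed.

Lemma frlim_cst L : frlim F (fun=> L) L.
Proof.
exists unit, (fun=> cst 1), (fun=> 1), (fun=> L); split.
- by move=> _; exact: cvg_cst.
- by near=> p; rewrite big_const card_unit /= addr0 scale1r.
- by rewrite big_const card_unit /= addr0 scale1r.
Unshelve. all: by end_near. Qed.

Lemma frlimD f g L M : frlim F f L -> frlim F g M ->
  frlim F (fun p => f p + g p) (L + M).
Proof.
move=> [I [p [l [v [c e eL]]]]] [J [q [m [w [c1 e1 eM]]]]].
exists (I + J)%type, (fun i => match i with inl i => p i | inr j => q j end),
  (fun i => match i with inl i => l i | inr j => m j end),
  (fun i => match i with inl i => v i | inr j => w j end).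
split=> [[i|j]||]; [exact: c|exact: c1| |].
  by apply: filterS2 e e1 => t -> ->; rewrite big_sumType.
by rewrite big_sumType/= eL eM.
Qed.

Lemma frlimN f L : frlim F f L -> frlim F (fun p => - f p) (- L).
Proof.
move=> [I [p [l [v [c e eL]]]]]; exists I, p, l, (fun i => - v i); split=> //.
  by apply: filterS e => t ->; rewrite -sumrN; apply: eq_bigr => i _; rewrite scalerN.
by rewrite eL -sumrN; apply: eq_bigr => i _; rewrite scalerN.
Qed.

Lemma frlim_sum (I : Type) (r : seq I) (P : pred I) (f : I -> T -> V) (L : I -> V) :
    (forall i, P i -> frlim F (f i) (L i)) ->
  frlim F (fun x => \sum_(i <- r | P i) f i x) (\sum_(i <- r | P i) L i).
Proof.
move=> df; elim: r => [|i r IH].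
  by rewrite big_nil; apply: frlim_ext (frlim_cst 0); near=> x; rewrite big_nil.
rewrite big_cons; case: (boolP (P i)) => Pi.
  by apply: frlim_ext (frlimD (df i Pi) IH); near=> x; rewrite big_cons Pi.
by apply: frlim_ext IH; near=> x; rewrite big_cons (negbTE Pi).
Unshelve. all: by end_near. Qed.

Lemma frlim_comp (S : Type) (G : set_system S) (u : S -> T) (FG : Filter G) f L :
  u x @[x --> G] --> F -> frlim F f L -> frlim G (fun x => f (u x)) L.
Proof.
move=> uF [I [p [l [v [c e eL]]]]]; exists I, (fun i x => p i (u x)), l, v; split=> //.
  by move=> i; exact: (cvg_comp _ _ uF (c i)).
exact: uF e.
Qed.

End Module.

Lemma frlimM (A : algType R[i]) (T : Type) (F : set_system T) {FF : Filter F}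
    (f g : T -> A) (L M : A) :
  frlim F f L -> frlim F g M -> frlim F (fun p => f p * g p) (L * M).
Proof.
move=> [I [p [l [v [c e eL]]]]] [J [q [m [w [c1 e1 eM]]]]].
exists (I * J)%type, (fun ij x => p ij.1 x * q ij.2 x), (fun ij => l ij.1 * m ij.2),
  (fun ij => v ij.1 * w ij.2); split.
- by move=> [i j]; apply: cvgM; [exact: c|exact: c1].
- apply: filterS2 e e1 => x -> ->; rewrite mulr_suml.
  under eq_bigr do rewrite mulr_sumr; rewrite pair_big/=.
  by apply: eq_bigr => -[i j] _ /=; rewrite -scalerAl -scalerAr scalerA -rmorphM.
- rewrite eL eM mulr_suml.
  under eq_bigr do rewrite mulr_sumr; rewrite pair_big/=.
  by apply: eq_bigr => -[i j] _ /=; rewrite -scalerAl -scalerAr scalerA -rmorphM.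
Qed.

End FiniteRankLimits.

(** * Functions smaller than all powers of the logarithm *)

Section SmallFunctions.
Variable R : realType.

(** With x = exp(-2 y), the product is bounded by a constant times exp(-2 y) y^m,
    hence by a constant times exp(-y) = x^(1/2). *)
Lemma cvg_mul_lnX m : (x : R) * ln x ^+ m @[x --> 0^'+] --> (0 : R).
Proof.
pose C : R := 2 ^+ m * m`!%:R.
have C0 : 0 <= C by rewrite mulr_ge0// exprn_ge0.
have cp : C * x `^ (1 / 2) @[x --> (0 : R)^'+] --> (0 : R).
  rewrite -[X in _ --> X](mulr0 C); apply: cvgMl_tmp.
  by apply: powR_cvg0; lra.
apply/cvgr0Pnorm_le => e e0; move/cvgr0Pnorm_le : cp => /(_ e e0) cp.
have near1 : \forall x \near (0 : R)^'+, 0 < x < 1.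
  by near=> x; apply/andP; split; near: x; [exact: nbhs_right_gt|exact: nbhs_right_lt].
apply: filterS2 cp near1 => x Cx /andP[x0 x1]; apply: le_trans Cx.
rewrite [leRHS]ger0_norm ?mulr_ge0 ?powR_ge0//.
rewrite normrM (gtr0_norm x0) normrX ler0_norm ?ln_le0 ?(ltW x1)//.
pose y := - ln x / 2; have y0 : 0 <= y by rewrite divr_ge0// oppr_ge0 ln_le0// ltW.
have my : y ^+ m / m`!%:R <= expR y.
  case: (m) => [|n]; first by rewrite expr0 fact0 divr1 -[leLHS]expR0 ler_expR.
  by rewrite (le_trans _ (expR_ge1Dxn n y0))// lerDr.
have xE : x `^ (1 / 2) = expR (- y).
  by rewrite /powR gt_eqF// /y; congr expR; field.
have xx : x = expR (- y) * expR (- y).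
  by rewrite -expRD -[LHS]lnK ?posrE//; congr expR; rewrite /y; field.
have -> : - ln x = 2 * y by rewrite /y; field.
rewrite xE exprMn {1}xx /C.
have E : expR (- y) * expR y = 1 by rewrite mulrC expRxMexpNx_1.
move: my; rewrite ler_pdivrMr ?ltr0n ?fact_gt0// => my.
have e1 := expR_ge0 (- y).
have := ler_wpM2l e1 my; rewrite mulrA E mul1r => le1.
rewrite [leLHS](_ : _ = 2 ^+ m * (expR (- y) * (expR (- y) * y ^+ m))); last by ring.
rewrite -mulrA [_`!%:R * _]mulrC.
by do 2!rewrite ler_wpM2l ?exprn_ge0//.
Unshelve. all: by end_near. Qed.

Variable A : algType R[i].
Implicit Types (f : R -> A).

(** Conjugation by x^X multiplies each coefficient by polynomials in ln x;
    this class is stable under it. *)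
Definition frsmall f := exists (I : finType) (phi : I -> R -> R) (v : I -> A),
  (forall i m, phi i x * ln x ^+ m @[x --> 0^'+] --> (0 : R)) /\
  \forall x \near 0^'+, f x = \sum_i (phi i x)%:C *: v i.

Lemma frsmall_ext f g : (\forall x \near 0^'+, f x = g x) -> frsmall f -> frsmall g.
Proof.
move=> fg [I [p [v [c e]]]]; exists I, p, v; split=> //.
by apply: filterS2 fg e => x <-.
Qed.

Lemma frsmall_frlim f : frsmall f -> frlim (0 : R)^'+ f 0.
Proof.
move=> [I [p [v [c e]]]]; exists I, p, (fun=> 0), v; split=> //.
  by move=> i; have := c i 0%N; under eq_fun do rewrite expr0 mulr1.
by rewrite big1// => i _; rewrite scale0r.
Qed.

Lemma frsmallMl f (j : nat) (r : R) (w : A) : frsmall f ->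
  frsmall (fun x => ((r * ln x ^+ j)%:C *: w) * f x).
Proof.
move=> [I [p [v [c e]]]]; exists I, (fun i x => r * (p i x * ln x ^+ j)),
  (fun i => w * v i).
split=> [i m|].
  rewrite (_ : (fun x => _) = (fun x => r * (p i x * ln x ^+ (j + m)))).
    by rewrite -[X in _ --> X](mulr0 r); apply: cvgMl_tmp; exact: c.
  by apply: funext => x; rewrite exprD !mulrA.
apply: filterS e => x ->; rewrite mulr_sumr; apply: eq_bigr => i _.
by rewrite -scalerAr -scalerAl scalerA -rmorphM; congr (_%:C *: _); ring.
Qed.

Lemma frsmallMr f (j : nat) (r : R) (w : A) : frsmall f ->
  frsmall (fun x => f x * ((r * ln x ^+ j)%:C *: w)).
Proof.
move=> [I [p [v [c e]]]]; exists I, (fun i x => r * (p i x * ln x ^+ j)),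
  (fun i => v i * w).
split=> [i m|].
  rewrite (_ : (fun x => _) = (fun x => r * (p i x * ln x ^+ (j + m)))).
    by rewrite -[X in _ --> X](mulr0 r); apply: cvgMl_tmp; exact: c.
  by apply: funext => x; rewrite exprD !mulrA.
apply: filterS e => x ->; rewrite mulr_suml; apply: eq_bigr => i _.
by rewrite -scalerAr -scalerAl scalerA -rmorphM; congr (_%:C *: _); ring.
Qed.

Lemma frsmallD f g : frsmall f -> frsmall g -> frsmall (fun x => f x + g x).
Proof.
move=> [I [p [v [c e]]]] [J [q [w [c1 e1]]]].
exists (I + J)%type, (fun i => match i with inl i => p i | inr j => q j end),
  (fun i => match i with inl i => v i | inr j => w j end).
split=> [[i|j]|]; [exact: c|exact: c1|].
by apply: filterS2 e e1 => t -> ->; rewrite big_sumType.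
Qed.

Lemma frsmall0 : frsmall (fun=> 0).
Proof.
exists void, (fun=> cst 0), (fun=> 0); split=> //.
by near=> x; rewrite big1// => -[].
Unshelve. all: by end_near. Qed.

Lemma frsmall_sum (I : Type) (r : seq I) (f : I -> R -> A) :
  (forall i, frsmall (f i)) -> frsmall (fun x => \sum_(i <- r) f i x).
Proof.
move=> df; elim: r => [|i r IH].
  by apply: frsmall_ext frsmall0; near=> x; rewrite big_nil.
by apply: frsmall_ext (frsmallD (df i) IH); near=> x; rewrite big_cons.
Unshelve. all: by end_near. Qed.

(** Such a function is O(x). *)
Lemma frsmall_hol (b : R) (f f' : R[i] -> A) :
  frhol b f f' -> f 0 = 0 -> frsmall (fun x => f x%:C).
Proof.
move=> [I [phi [phi' [v H]]]] f0.
have b0 : b * cabs (0 : R[i]) < 1 by rewrite cabs0 mulr0.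
have [dphi f0E _] := H 0 b0.
pose psi i (x : R) := phi i x%:C - phi i 0.
have psi_le i : exists2 C, 0 <= C & \forall x \near (0 : R)^'+, cabs (psi i x) <= C * x.
  have [M [del [M0 del0 D]]] := dphi i.
  exists (cabs (phi' i 0) + M * del);
    first by rewrite addr_ge0 ?cabs_ge0// mulr_ge0// ltW.
  near=> x; have x0 : 0 < x by near: x; exact: nbhs_right_gt.
  have xd : x <= del by near: x; exact: nbhs_right_le.
  have cx : cabs x%:C = x by rewrite cabsC gtr0_norm.
  have := D x%:C; rewrite cx add0r => /(_ xd) le1.
  have -> : psi i x = (phi i x%:C - phi i 0 - phi' i 0 * x%:C) + phi' i 0 * x%:C.
    by rewrite /psi subrK.
  rewrite (le_trans (ler_cabsD _ _))// addrC mulrDl cabsM cx lerD//.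
  by rewrite (le_trans le1)// expr2 mulrA ler_wpM2r ?(ltW x0)// ler_wpM2l.
have small (q : R -> R) i m : (forall x, `|q x| <= cabs (psi i x)) ->
    q x * ln x ^+ m @[x --> 0^'+] --> (0 : R).
  move=> qle; have [C C0 psiC] := psi_le i.
  have c1 : C * (x * ln x ^+ m) @[x --> (0 : R)^'+] --> (0 : R).
    by rewrite -[X in _ --> X](mulr0 C); apply: cvgMl_tmp; exact: cvg_mul_lnX.
  apply/cvgr0Pnorm_le => e e0; move/cvgr0Pnorm_le : c1 => /(_ e e0) c1.
  near=> x; have x0 : 0 < x by near: x; exact: nbhs_right_gt.
  apply: (@le_trans _ _ `|C * (x * ln x ^+ m)|); last by near: x.
  rewrite normrM !mulrA [leRHS]normrM ler_wpM2r// (le_trans (qle x))//.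
  by rewrite ger0_norm ?mulr_ge0 ?(ltW x0)//; near: x.
have sRe : frsmall (fun x => \sum_i (complex.Re (psi i x))%:C *: v i).
  exists I, (fun i x => complex.Re (psi i x)), v; split=> [i m|]; last by near=> x.
  by apply: (small _ i) => x; exact: Re_le_cabs.
have sIm : frsmall (fun x => \sum_i (complex.Im (psi i x))%:C *: ('i *: v i)).
  exists I, (fun i x => complex.Im (psi i x)), (fun i => 'i *: v i).
  split=> [i m|]; last by near=> x.
  by apply: (small _ i) => x; exact: Im_le_cabs.
apply: frsmall_ext (frsmallD sRe sIm); near=> x.
have bx : b * cabs x%:C < 1.
  have x0 : 0 < x by near: x; exact: nbhs_right_gt.
  rewrite cabsC gtr0_norm// (le_lt_trans (ler_wpM2r (ltW x0) (ler_norm b)))//.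
  have xb : x < (`|b| + 1)^-1 by near: x; apply: nbhs_right_lt;
    rewrite invr_gt0 ltr_wpDl.
  have : (`|b| + 1) * x < 1 by rewrite mulrC -ltr_pdivlMr ?ltr_wpDl// mul1r.
  by apply: le_lt_trans; rewrite ler_wpM2r ?(ltW x0)// lerDl.
have [_ fE _] := H _ bx.
have -> : f x%:C = f x%:C - f 0 by rewrite f0 subr0.
rewrite fE f0E -sumrB -big_split/=.
apply: eq_bigr => i _; rewrite /= scalerA -scalerDl -scalerBl; congr (_ *: _).
by rewrite [(_ _)%:C * _]mulrC -complexReIm.
Unshelve. all: by end_near. Qed.

End SmallFunctions.


(** * The associator compares two local solutions *)

Section Regularization.
Variables (R : realType) (A : algType R[i]).
Implicit Types (X Y Z W : A).

(** h(x) - 1 is O(x) in every degree, and conjugation by x^X costs only powers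
    of ln x. *)
Lemma bracket_limit (b : R) X Y Z beta gamma (h : R[i] -> fps A) n :
  local_sol b X Y Z beta gamma h ->
  frlim (0 : R)^'+
    (fun x => (fps_exp (- ln x)%:C X * h x%:C * fps_exp (ln x)%:C X) n)
    ((1 : fps A) n).
Proof.
move=> [h0 h1 [dh [fr _]]].
have E x : fps_exp (- ln x)%:C X * h x%:C * fps_exp (ln x)%:C X =
    1 + fps_exp (- ln x)%:C X * (h x%:C - 1) * fps_exp (ln x)%:C X.
  rewrite mulrBr mulrBl mulr1 rmorphN fps_expNK.
  by rewrite addrC subrK.
have small m : frsmall (fun x : R => (h x%:C - 1) m).
  case: m => [|m].
    apply: frsmall_ext (frsmall0 A); near=> x.
    by rewrite fpsDE fpsNE h0 fps1E subrr.
  apply: frsmall_ext (frsmall_hol (fr m.+1) _); last by rewrite h1.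
  by near=> x; rewrite fpsDE fpsNE fps1E subr0.
apply: (@frlim_ext _ _ _ _ _ (fun x => (1 : fps A) n +
    (fps_exp (- ln x)%:C X * (h x%:C - 1) * fps_exp (ln x)%:C X) n)).
  by near=> x; rewrite E.
rewrite -[X in frlim _ _ X]addr0; apply: frlimD; first exact: frlim_cst.
apply: frsmall_frlim.
have expE (r x : R) j : fps_exp (r * ln x)%:C X j =
    ((r ^+ j / j`!%:R) * ln x ^+ j)%:C *: X ^+ j.
  rewrite /fps_exp -rmorphXn/= exprMn; congr (_ *: _).
  by rewrite -(rmorph_nat (real_complex R)) -fmorphV -rmorphM/=; congr (_%:C);
    rewrite mulrAC.
apply: (@frsmall_ext _ _ (fun x => \sum_(k < n.+1) \sum_(j < k.+1)
    fps_exp (- ln x)%:C X j * (h x%:C - 1) (k - j)%N * fps_exp (ln x)%:C X (n - k)%N)).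
  near=> x; rewrite [RHS]fpsME; apply: eq_bigr => k _.
  by rewrite [X in _ = X * _]fpsME mulr_suml.
apply: frsmall_sum => k; apply: frsmall_sum => j.
apply: (@frsmall_ext _ _ (fun x => ((((-1) ^+ j / j`!%:R) * ln x ^+ j)%:C *: X ^+ j) *
   (h x%:C - 1) (k - j)%N *
   (((1 ^+ (n - k) / (n - k)`!%:R) * ln x ^+ (n - k))%:C *: X ^+ (n - k)))).
  by near=> x; rewrite -!expE mulN1r mul1r.
exact/frsmallMr/frsmallMl/small.
Unshelve. all: by end_near. Qed.

(** P M = N K is triangular in the power of lambda, with M = 1 in degree 0, so
    the limits of the coefficients of P follow one after the other. *)
Lemma frlim_quotient (T : Type) (F : set_system T) {FF : Filter F}
    (P M N : T -> fps A) (K : fps A) :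
    (\forall p \near F, P p * M p = N p * K /\ M p 0%N = 1) ->
    (forall n, frlim F (fun p => M p n) ((1 : fps A) n)) ->
    (forall n, frlim F (fun p => N p n) ((1 : fps A) n)) ->
  forall n, frlim F (fun p => P p n) (K n).
Proof.
move=> PM cM cN n; elim/ltn_ind: n => n IH.
have cNK : frlim F (fun p => (N p * K) n) (K n).
  rewrite (_ : K n = \sum_(k < n.+1) (1 : fps A) k * K (n - k)%N); last first.
    by rewrite -fpsME mul1r.
  by apply: frlim_sum => k _; apply: frlimM; [exact: cN|exact: frlim_cst].
have cS : frlim F (fun p => \sum_(k < n) P p k * M p (n - k)%N)
    (\sum_(k < n) K k * (1 : fps A) (n - k)%N).
  by apply: frlim_sum => k _; apply: frlimM; [exact: IH|exact: cM].
rewrite (_ : \sum_(k < n) _ = 0) in cS; last first.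
  by rewrite big1// => k _; rewrite fps1E subn_eq0 leqNgt ltn_ord mulr0.
have H := frlimD cNK (frlimN cS); rewrite subr0 in H; apply: (frlim_ext _ (H FF FF)).
apply: filterS PM => p [<- M0]; rewrite fpsME big_ord_recr/= subnn M0 mulr1.
by rewrite addrC addrK.
Qed.

Lemma reg_filter_proper : ProperFilter (@reg_filter R).
Proof.
split; last exact: within_filter.
move=> /nbhs_ballP[e/= e0 H].
pose r := Num.min (e / 2) 4^-1.
have r0 : 0 < r by rewrite lt_min divr_gt0//= invr_gt0.
have r4 : r <= 4^-1 by rewrite ge_min lexx orbT.
have re : r < e by rewrite gt_min; apply/orP; left;
  rewrite ltr_pdivrMr// ltr_pMr// ltr1n.
apply: (H (r, r)) => /=; last by rewrite r0 r4.
by split; rewrite /ball/= sub0r normrN gtr0_norm.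
Qed.

Lemma reg_filter_dom : \forall p \near @reg_filter R,
  0 < p.1 <= 4^-1 /\ 0 < p.2 <= 4^-1.
Proof. exact: withinT. Qed.

Lemma reg_filter_fst : p.1 @[p --> @reg_filter R] --> (0 : R)^'+.
Proof.
move=> U /nbhs_ballP[e/= e0 H]; apply/nbhs_ballP;
  exists e => //= p [p1 _] [/andP[d0 _] _].
exact: H.
Qed.

Lemma reg_filter_snd : p.2 @[p --> @reg_filter R] --> (0 : R)^'+.
Proof.
move=> U /nbhs_ballP[e/= e0 H]; apply/nbhs_ballP;
  exists e => //= p [_ p2] [_ /andP[d0 _]].
exact: H.
Qed.

(** One norm suffices, but there must be one. *)
Lemma is_reg_lim_unique (V : lmodType R[i]) (f : R * R -> V) (L M : V) :
  is_reg_lim f L -> is_reg_lim f M -> L = M.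
Proof.
have [N nN] := exists_norm V; move=> /(_ N nN) fL /(_ N nN) fM.
have PF := reg_filter_proper.
have [N0 Neq0 ND NZ] := nN.
have Nopp x : N (- x) = N x.
  by have := NZ (-1) x; rewrite scaleN1r normrN1 mul1r => /complexI.
apply/eqP; rewrite -subr_eq0; apply/eqP/Neq0/eqP; rewrite eq_le N0 andbT.
apply/ler_addgt0Pr => e e0; rewrite add0r.
have e2 : 0 < e / 2 by rewrite divr_gt0.
move/cvgr0Pnorm_le : fL => /(_ _ e2) fL; move/cvgr0Pnorm_le : fM => /(_ _ e2) fM.
have [p [pL pM]] := filter_ex (filterI fL fM).
have -> : L - M = - (f p - L) + (f p - M) by rewrite opprB addrA subrK.
rewrite (le_trans (ND _ _))// Nopp (splitr e) lerD//.
  by rewrite (le_trans (ler_norm _)).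
by rewrite (le_trans (ler_norm _)).
Qed.

(** The solutions G(x) = gXY(x) x^X and H(x) = gYX(1 - x) (1 - x)^Y of the
    equation of the transport satisfy G = H K at x = 1/2, hence beyond. The
    transport W from d to 1 - e therefore satisfies W G(d) = H(1 - e) K. This reads
    P (d^(-X) gXY(d) d^X) = (e^(-Y) gYX(e) e^Y) K for the regularized transport P, and
    the two conjugates tend to 1. *)
Theorem drinfeld_associatorE X Y (gXY gYX : R[i] -> fps A) (K : fps A) :
    local_sol 1 X Y 0 1 0 gXY -> local_sol 1 Y X 0 1 0 gYX ->
    gXY (1 / 2) * fps_exp (- ln 2)%:C X = gYX (1 / 2) * fps_exp (- ln 2)%:C Y * K ->
  drinfeld_associator X Y = K.
Proof.
move=> solXY solYX XYK.
pose om (x : R) : fps A := x%:C^-1 *: lam X - (1 - x%:C)^-1 *: lam Y.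
have om0 x : om x 0%N = 0 by rewrite /om fpsDE fpsNE !fpsZE /lam/= !scaler0 subrr.
pose G (x : R) := gXY x%:C * fps_exp (ln x)%:C X.
pose H (x : R) := gYX (1 - x)%:C * fps_exp (ln (1 - x))%:C Y.
(* G and H solve the equation of the transport on ]0, 1[ *)
have dG (u v : R) : 0 < u -> v < 1 -> exists G', fpsderiv u v G G' /\
    forall x, x \in `]u, v[ -> G' x = om x * G x.
  move=> u0 v1; have pos x : x \in `[u, v] -> 0 < x < 1.
    by rewrite in_itv/= => /andP[ux xv];
      rewrite (lt_le_trans u0 ux) (le_lt_trans xv v1).
  have [|x /pos/andP[x0 x1]|x /pos/andP[x0 x1]|x /pos/andP[x0 x1]|G' [dG eG]] :=
      @local_sol_transport _ _ 1 X Y 0 1 0 gXY u v (fun x => x%:C) (fun=> 1)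
        (fun x => (ln x)%:C) solXY.
  - by move=> x _; apply: cderiv_real; exact: is_derive_id.
  - by rewrite mul1r cabsC gtr0_norm.
  - by apply/eqP => -[E]; rewrite E ltxx in x0.
  - by rewrite mul1r -fmorphV; apply: cderiv_real; exact: is_derive1_ln.
  exists G'; split=> // x xuv; by rewrite eG// /om !mul1r !mul0r scale0r subr0.
have dH (u v : R) : 0 < u -> v < 1 -> exists H', fpsderiv u v H H' /\
    forall x, x \in `]u, v[ -> H' x = om x * H x.
  move=> u0 v1; have pos x : x \in `[u, v] -> 0 < x < 1.
    by rewrite in_itv/= => /andP[ux xv];
      rewrite (lt_le_trans u0 ux) (le_lt_trans xv v1).
  have [|x /pos/andP[x0 x1]|x /pos/andP[x0 x1]|x /pos/andP[x0 x1]|H' [dH eH]] :=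
      @local_sol_transport _ _ 1 Y X 0 1 0 gYX u v (fun x => (1 - x)%:C) (fun=> -1)
        (fun x => (ln (1 - x))%:C) solYX.
  - move=> x _; have -> : (fun y : R => (1 - y)%:C) = (fun y => 1 + (-1) * y%:C).
      by apply: funext => y; rewrite mulN1r rmorphB rmorph1.
    exact: cderiv_affine.
  - by rewrite mul1r cabsC gtr0_norm ?subr_gt0// ltrBlDr ltrDl.
  - by apply/eqP => -[E]; move: x1; rewrite -subr_gt0 E ltxx.
  - rewrite mulN1r -fmorphV -rmorphN; apply: cderiv_real.
    have D : is_derive x 1 (fun y : R => 1 - y) (-1).
      have := is_deriveB (is_derive_cst (1 : R) x 1) (is_derive_id x (1 : R)).
      by rewrite sub0r.
    have x1' : 0 < 1 - x by rewrite subr_gt0.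
    have := @is_derive1_comp _ (@ln R) _ x _ _ (is_derive1_ln x1') D.
    by rewrite mulrN1.
  exists H'; split=> // x xuv; rewrite eH// /om /H !mul1r !mul0r scale0r subr0.
  by rewrite rmorphB rmorph1 !mulN1r subKr !scaleNr opprK addrC.
have uniq (u v : R) (F1 F2 F1' F2' : R -> fps A) : u <= v ->
    fpsderiv u v F1 F1' -> (forall x, x \in `]u, v[ -> F1' x = om x * F1 x) ->
    fpsderiv u v F2 F2' -> (forall x, x \in `]u, v[ -> F2' x = om x * F2 x) ->
    F1 u = F2 u -> F1 v = F2 v.
  move=> uv d1 e1 d2 e2 E; apply/eqP; rewrite -subr_eq0; apply/eqP.
  have := fpsderiv_unique uv (fpsderivB d1 d2).
  rewrite E subrr => /(_ erefl)/(_ _ v); apply; last by rewrite in_itv/= uv lexx.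
  move=> x n xuv low; rewrite e1// e2// -mulrBr.
  exact: (vanish_toMl (om0 x) low).
have half : 1 / 2 < 1 :> R by lra.
have GHK (x : R) : 1 / 2 <= x < 1 -> G x = H x * K.
  move=> /andP[x2 x1]; have u0 : 0 < 1 / 2 :> R by lra.
  have [G' [dG1 eG1]] := dG _ _ u0 x1; have [H' [dH1 eH1]] := dH _ _ u0 x1.
  apply: (uniq _ _ _ _ _ _ x2 dG1 eG1 (fpsderivMr K dH1)).
    by move=> y yx; rewrite eH1// mulrA.
  have E1 : 1 - 1 / 2 = 1 / 2 :> R by lra.
  have ln2 : ln (1 / 2) = - ln 2 :> R by rewrite mul1r lnV// posrE.
  have h2 : (1 / 2 : R)%:C = 1 / 2 by rewrite rmorphM rmorph1 fmorphV rmorph_nat.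
  by rewrite /G /H E1 ln2 h2.
(* W G(d) is the solution G at 1 - e, which lies beyond 1/2 *)
have TG (p : R * R) : 0 < p.1 <= 4^-1 -> 0 < p.2 <= 4^-1 ->
    transport X Y p.1 p.2 * G p.1 = H (1 - p.2) * K.
  case: p => d e /= /andP[d0 d4] /andP[e0 e4].
  have e1 : 1 - e < 1 by lra.
  have de : d < 1 - e by lra.
  rewrite -GHK; last by apply/andP; split; lra.
  have [T' [dT eT]] := transport_to_deriv X Y d0 de e1.
  have [G' [dG1 eG1]] := dG _ _ d0 e1.
  apply: (uniq _ _ _ _ _ _ (ltW de) (fpsderivMr (G d) dT) _ dG1 eG1).
    by move=> x xde; rewrite eT// mulrA.
  by rewrite transport_to_start// mul1r.
pose P (p : R * R) : fps A := fps_exp (- ln p.2)%:C Y * transport X Y p.1 p.2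
   * fps_exp (ln p.1)%:C X.
have lim n : frlim (@reg_filter R) (fun p => P p n) (K n).
  have FF := @filter_filter _ _ reg_filter_proper.
  have c1 := fun n => @frlim_comp _ _ _ _ _ _ _ FF _ _ reg_filter_fst
    (bracket_limit n solXY).
  have c2 := fun n => @frlim_comp _ _ _ _ _ _ _ FF _ _ reg_filter_snd
    (bracket_limit n solYX).
  apply: (frlim_quotient _ c1 c2); apply: filterS reg_filter_dom => p [p1 p2]; split.
    have := TG p p1 p2; rewrite /G /H subKr => E.
    rewrite /P -[LHS]mulrA [fps_exp _ X * (_ * _)]mulrA [fps_exp _ X * (_ * _)]mulrA.
    by rewrite !rmorphN fps_expKN mul1r -!mulrA E -!mulrA.
  by rewrite fpsME big_ord1 fpsME big_ord1 !fps_exp_0 mul1r mulr1; case: solXY => ->.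
apply: funext => n; rewrite /drinfeld_associator.
set S := (X in xget 0 X); have SK : S (K n).
  by move=> N nN; apply: frlim_norm => //; exact: lim.
have SL : S (xget 0 S) by apply: xgetPex; exists (K n).
exact: is_reg_lim_unique SL SK.
Qed.

End Regularization.


(** * The logarithms at the sixth roots of unity *)

Section Angles.
Variable R : realType.

Let r3 : R := Num.sqrt 3.

Let r3_gt0 : 0 < r3. Proof. by rewrite sqrtr_gt0. Qed.
Let r3_sqr : r3 ^+ 2 = 3. Proof. by rewrite sqr_sqrtr. Qed.

(** exp(- i pi / 3). *)
Definition root6 : R[i] := (1 / 2) +i* (- (r3 / 2)).

Lemma root6_sixth : prim_sixth_root root6.
Proof. by split => //=; rewrite sqrrN exprMn r3_sqr; field. Qed.

(** From cos(3 y) = 0 for y = pi / 6. *)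
Let cos_sin_pi6 : cos (pi / 6 : R) = r3 / 2 /\ sin (pi / 6 : R) = 1 / 2.
Proof.
have pi0 := pi_gt0 R; set y : R := pi / 6.
have c0 : 0 < cos y by apply: cos_gt0_pihalf; rewrite /y; apply/andP; split; lra.
have s0 : 0 < sin y by apply: sin_gt0_pi; rewrite /y; apply/andP; split; lra.
have y3 : cos (y + y + y) = 0.
  by rewrite (_ : y + y + y = pi / 2) ?cos_pihalf// /y; field.
move: y3; rewrite !cosD !sinD.
have := cos2Dsin2 y; move: (cos y) (sin y) c0 s0 => c s c0 s0 cs y3.
have c2 : c ^+ 2 = 3 * s ^+ 2.
  by apply: (mulfI (lt0r_neq0 c0)); move: y3; rewrite !expr2; lra.
have s2 : s = 1 / 2.
  have h0 : 0 <= 1 / 2 :> R by lra.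
  apply: (pexpIrn (_ : (0 < 2)%N)); rewrite ?nnegrE ?(ltW s0)//.
  by move: cs c2; rewrite !expr2; lra.
split=> //; have h0 : 0 <= r3 / 2 by rewrite divr_ge0// ltW.
apply: (pexpIrn (_ : (0 < 2)%N)); rewrite ?nnegrE ?(ltW c0)//.
by rewrite exprMn r3_sqr c2 s2; field.
Qed.

Lemma atan_inv_sqrt3 : atan (r3 / 3) = pi / 6.
Proof.
have pi0 := pi_gt0 R; have [c s] := cos_sin_pi6.
rewrite -[RHS]tanK; last by rewrite in_itv/=; apply/andP; split; lra.
congr atan; rewrite /tan c s; have r0 := lt0r_neq0 r3_gt0.
apply: (mulIf r0); rewrite mulrAC -expr2 r3_sqr; field.
by rewrite r0.
Qed.

Lemma atan_sqrt3 : atan r3 = pi / 3.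
Proof.
have pi0 := pi_gt0 R; have [c s] := cos_sin_pi6.
rewrite -[RHS]tanK; last by rewrite in_itv/=; apply/andP; split; lra.
rewrite (_ : pi / 3 = pi / 6 + pi / 6); last by field.
congr atan; rewrite /tan cosD sinD c s.
have -> : r3 / 2 * (r3 / 2) - 1 / 2 * (1 / 2) = 1 / 2.
  by have := r3_sqr; rewrite expr2 => E; lra.
by field.
Qed.

Let ln34 : R := ln (3 / 4) / 2.

Lemma clog_root6 : clog root6 = 0 +i* (- (pi / 3)).
Proof.
rewrite /clog /root6/=; congr (_ +i* _).
  by rewrite sqrrN !exprMn r3_sqr (_ : _ + _ = 1) ?ln1 ?mul0r//; field.
by rewrite -atan_sqrt3 -atanN; congr atan; field.
Qed.

Lemma clog_1sub_root6 : clog (1 - root6) = 0 +i* (pi / 3).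
Proof.
rewrite /clog /root6/=; congr (_ +i* _).
  by rewrite add0r opprK !exprMn r3_sqr (_ : _ + _ = 1) ?ln1 ?mul0r//; field.
by rewrite -atan_sqrt3; congr atan; field.
Qed.

(** The values of 1 - k x and 1 - (1 - k) x at x = 1/2 are conjugate, of square
    modulus 3 / 4. *)
Lemma clog_mid1 : clog (1 - root6 / 2) = ln34 +i* (pi / 6).
Proof.
rewrite (_ : 1 - root6 / 2 = (3 / 4) +i* (r3 / 4)); last first.
  by apply: (mulIf (_ : 2 != 0)); rewrite ?pnatr_eq0// mulrBl divfK ?pnatr_eq0//;
    apply: complex_eqP; rewrite /root6/=; field.
rewrite /clog /=; congr (_ +i* _).
  by rewrite /ln34; congr (ln _ / 2); rewrite !exprMn r3_sqr; field.
by rewrite -atan_inv_sqrt3; congr atan; field.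
Qed.

Lemma clog_mid2 : clog (1 - (1 - root6) / 2) = ln34 +i* (- (pi / 6)).
Proof.
rewrite (_ : 1 - (1 - root6) / 2 = (3 / 4) +i* (- (r3 / 4))); last first.
  by apply: (mulIf (_ : 2 != 0)); rewrite ?pnatr_eq0// mulrBl divfK ?pnatr_eq0//;
    apply: complex_eqP; rewrite /root6/=; field.
rewrite /clog /=; congr (_ +i* _).
  by rewrite /ln34; congr (ln _ / 2); rewrite sqrrN !exprMn r3_sqr; field.
by rewrite -atan_inv_sqrt3 -atanN; congr atan; field.
Qed.

End Angles.


(** * The hexagon *)

Lemma solve_connection (T : pzRingType) (P K y r rV z zV z' u : T) :
    P * (r * zV) = y * z' * K -> zV * z = 1 -> r * rV = 1 ->
    GRing.comm K z' -> GRing.comm rV u -> u = z' * z ->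
  P = y * K * rV * u.
Proof.
move=> E zz rr Kz ru uE; transitivity (P * (r * zV) * (z * rV)).
  by rewrite -!mulrA (mulrA zV) zz mul1r rr mulr1.
by rewrite E -(mulrA y) -Kz -!mulrA ru uE !mulrA.
Qed.

Lemma hexagon_regroup (T : pzRingType)
    (w e ex ez ey tx tz ty Kzx Kyz Kxy rz ry rx : T) :
    GRing.comm w ez -> GRing.comm w tz -> GRing.comm w Kyz ->
    GRing.comm w ry -> GRing.comm w ey -> GRing.comm w ty ->
    GRing.comm w Kxy -> GRing.comm w rx ->
    rz * ez * tz = 1 -> ry * ey * ty = 1 -> ex * tx * rx = 1 ->
    Kzx * Kyz * Kxy = 1 -> w * w * w = e ->
  e = ex * (tx * Kzx * rz * w) * ez * (tz * Kyz * ry * w) * ey * (ty * Kxy * rx * w).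
Proof.
move=> wez wtz wKyz wry wey wty wKxy wrx zz yy xx KKK <-.
have c1 : GRing.comm w (ez * (tz * Kyz * ry)).
  by apply: commrM => //; do 2?[apply: commrM => //].
have c2 : GRing.comm w (ey * (ty * Kxy * rx)).
  by apply: commrM => //; do 2?[apply: commrM => //].
symmetry; transitivity (ex * tx * Kzx * rz * (w * (ez * (tz * Kyz * ry))) *
    (w * (ey * (ty * Kxy * rx))) * w); first by rewrite !mulrA.
rewrite c1.
transitivity (ex * tx * Kzx * (rz * ez * tz) * Kyz * ry *
    (w * (w * (ey * (ty * Kxy * rx)))) * w); first by rewrite !mulrA.
rewrite c2 (mulrA w) c2 zz mulr1.
transitivity (ex * tx * (Kzx * Kyz * (ry * ey * ty) * Kxy) * rx * w * w * w).
  by rewrite !mulrA.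
by rewrite yy mulr1 KKK mulr1 xx mul1r.
Qed.

Section Hexagon.
Variables (R : realType) (A : algType R[i]).
Implicit Types X Y Z L : A.

Let k : R[i] := root6 R.
Let sk : prim_sixth_root k := root6_sixth R.
Let b : R := 2 / 3.
Let beta : R[i] := (1 + k) / 3.
Let gamma : R[i] := (2 - k) / 3.
Let s : R := ln 2 + ln (3 / 4) / 2.
Let theta : R[i] := s +i* (pi / 2).
Let theta' : R[i] := s +i* (- (pi / 2)).

(** The local solution at one cube root of unity, in the coordinate 1 - w / zeta,
    with residues X at zeta, Y at zeta k^2 and Z at zeta k^4. The same
    parameters serve at the three roots, by rotation. *)
Definition root_sol X Y Z (h : R[i] -> fps A) := local_sol b X Y Z beta gamma h.

(** The poles are at distance sqrt 3 from the root, hence outside the disk of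
    radius 3/2, which contains the origin w = 0 at distance 1. *)
Lemma root_pole_bound (k' : R[i]) : prim_sixth_root k' -> cabs ((1 + k') / 3) <= b.
Proof.
move=> sk'; rewrite -(@ler_pXn2r _ 2) ?nnegrE ?cabs_ge0// ?/b; last by lra.
rewrite cabsM cabsV cabs_nat exprMn.
have -> : cabs (1 + k') ^+ 2 = 3.
  rewrite sqr_cabs cReD cImD; case: sk' => -> I2 /=; rewrite add0r I2; lra.
by rewrite !expr2; lra.
Qed.

Lemma exists_root_sol X Y Z : exists h, root_sol X Y Z h.
Proof.
apply: exists_local_sol; first by rewrite /b; lra.
  exact: root_pole_bound.
have -> : gamma = (1 + (1 - k)) / 3 by rewrite /gamma; congr (_ / 3); ring.
exact/root_pole_bound/sixth_conj.
Qed.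

Lemma center_in_disk : b * cabs (1 : R[i]) < 1.
Proof. by rewrite (cabs_nat R 1) mulr1 /b; lra. Qed.

Lemma transition_comm X Y Z L (hX hY : R[i] -> fps A) (K : fps A) t :
    GRing.comm L X -> GRing.comm L Y -> GRing.comm L Z ->
    root_sol X Y Z hX -> root_sol Y Z X hY -> hX 1 = hY 1 * K ->
  GRing.comm K (fps_exp t L).
Proof.
move=> LX LY LZ solX solY XY.
have zX : GRing.comm (hX 1) (fps_exp t L).
  exact/comm_fps_exp/(local_sol_comm solX center_in_disk).
have zY : GRing.comm (hY 1) (fps_exp t L).
  exact/comm_fps_exp/(local_sol_comm solY center_in_disk).
have hY0 : hY 1 0%N = 1 by case: solY.
apply: (fps_mulI hY0); rewrite mulrA -XY zX XY mulrA -zY mulrA.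
by rewrite -!mulrA.
Qed.

(** With the comparison applied to both ends of the arc, both solutions on the
    unit interval are, at x = 1/2, solutions based at the cube roots, up to
    powers of the leading coefficients of the homographies. These coefficients are
    1 - 2 k = i sqrt 3 and its conjugate, and theta and theta' are their
    logarithms. The central factor is the quotient of the two powers of
    X + Y + Z produced by the comparisons. *)
Lemma associator_transition X Y Z L (hX hY : R[i] -> fps A) (K : fps A) :
    L = X + Y + Z -> GRing.comm L X -> GRing.comm L Y -> GRing.comm L Z ->
    root_sol X Y Z hX -> root_sol Y Z X hY -> hX 1 = hY 1 * K ->
  drinfeld_associator X Y =
    fps_exp theta' Y * K * fps_exp (- theta) X * fps_exp (0 +i* (pi / 3)) L.
Proof.
move=> LE LX LY LZ solX solY XY.
have [gXY solXY] : exists g, local_sol 1 X Y (0 : A) 1 0 g.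
  by apply: exists_local_sol; rewrite ?cabs0 ?(cabs_nat R 1).
have [gYX solYX] : exists g, local_sol 1 Y X (0 : A) 1 0 g.
  by apply: exists_local_sol; rewrite ?cabs0 ?(cabs_nat R 1).
have g0 g U V : local_sol 1 U V (0 : A) 1 0 g ->
  (g (1 / 2) * fps_exp (- ln 2)%:C U) 0%N = 1.
  by move=> [gg _ _]; rewrite fpsME big_ord1 gg fps_exp_0 mulr1.
have [Phi PhiE] := fps_div (gXY (1 / 2) * fps_exp (- ln 2)%:C X) (g0 _ _ _ solYX).
rewrite (drinfeld_associatorE solXY solYX PhiE).
have T := transition sk solX solY XY.
have CX : hX (1 - k) * fps_exp (- clog (1 - k / 2)) X =
    gXY (1 / 2) * fps_exp (- clog (1 - k / 2)) L.
  rewrite LE; apply: (comparison sk _ _ _ solX solXY); rewrite -LE//.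
  exact: commr0.
have CY : hY k * fps_exp (- clog (1 - (1 - k) / 2)) Y =
    gYX (1 / 2) * fps_exp (- clog (1 - (1 - k) / 2)) L.
  have E : Y + X + Z = L by rewrite LE (addrC X).
  have solY' : local_sol b Y X Z ((1 + (1 - k)) / 3) ((2 - (1 - k)) / 3) hY.
    have -> : (1 + (1 - k)) / 3 = gamma by rewrite /gamma; congr (_ / 3); ring.
    have -> : (2 - (1 - k)) / 3 = beta by rewrite /beta; congr (_ / 3); ring.
    exact: local_solC.
  have := comparison (sixth_conj sk) _ _ _ solY' solYX.
  rewrite subKr E; apply => //; exact: commr0.
have zK t : GRing.comm K (fps_exp t L) by exact: transition_comm solX solY XY.
have side (U : A) (g h : fps A) (l m : R[i]) : GRing.comm L U ->
    h * fps_exp (- l) U = g * fps_exp (- l) L ->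
    h * fps_exp m U =
    g * fps_exp (- ln 2)%:C U * (fps_exp ((ln 2)%:C + l + m) U * fps_exp (- l) L).
  move=> LU E; transitivity (h * fps_exp (- l) U * fps_exp (l + m) U).
    by rewrite -mulrA -fps_expD addKr.
  rewrite E -!mulrA; congr (g * _).
  rewrite (fps_exp_comm _ _ LU) mulrA -fps_expD; congr (fps_exp _ _ * _).
  by rewrite rmorphN -addrA addKr.
have := T; rewrite (side _ _ _ _ _ LX CX) (side _ _ _ _ _ LY CY) PhiE.
have -> : (ln 2)%:C + clog (1 - k / 2) + clog (1 - k) = theta.
  by rewrite clog_mid1 clog_1sub_root6; apply: complex_eqP; rewrite /theta /s /=; field.
have -> : (ln 2)%:C + clog (1 - (1 - k) / 2) + clog k = theta'.
  by rewrite clog_mid2 clog_root6; apply: complex_eqP; rewrite /theta' /s /=; field.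
have := g0 _ _ _ solYX; move: (gYX _ * fps_exp _ Y) => f f0.
rewrite -[f * _ * _]mulrA -[f * _ * _]mulrA => /(fps_mulI f0) E.
have <- : clog (1 - k / 2) - clog (1 - (1 - k) / 2) = 0 +i* (pi / 3).
  by rewrite clog_mid1 clog_mid2; apply: complex_eqP; rewrite /=; field.
set l := clog (1 - k / 2) in E *; set l' := clog (1 - (1 - k) / 2) in E *.
apply: (solve_connection E); [exact: fps_expNK|exact: fps_expKN|exact: zK| |].
  exact: fps_exp_comm.
by rewrite -fps_expD [- l' + l]addrC.
Qed.

Let sum_thetas : theta - theta' = 0 +i* pi.
Proof. by apply: complex_eqP; rewrite /theta /theta' /=; field. Qed.

(** The three transition elements at w = 0 multiply to 1, and between two of
    them - theta + i pi + theta' = 0 cancels the exponentials. The three central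
    factors make up the left-hand side. *)
Theorem hexagon_equation (x y z : A) :
    GRing.comm (x + y + z) x -> GRing.comm (x + y + z) y ->
    GRing.comm (x + y + z) z ->
  let ipi : R[i] := 0 +i* pi in
  fps_exp ipi (x + y + z) =
    fps_exp ipi x * drinfeld_associator z x * fps_exp ipi z * drinfeld_associator y z
      * fps_exp ipi y * drinfeld_associator x y.
Proof.
set L := x + y + z => Lx Ly Lz ipi.
have [hx solx] := exists_root_sol x y z.
have [hy soly] := exists_root_sol y z x.
have [hz solz] := exists_root_sol z x y.
have h0 X Y Z h : root_sol X Y Z h -> h 1 0%N = 1 by case.
have [Kxy Exy] := fps_div (hx 1) (h0 _ _ _ _ soly).
have [Kyz Eyz] := fps_div (hy 1) (h0 _ _ _ _ solz).
have [Kzx Ezx] := fps_div (hz 1) (h0 _ _ _ _ solx).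
have KKK : Kzx * Kyz * Kxy = 1.
  apply: (fps_mulI (h0 _ _ _ _ solx)).
  by rewrite mulr1 !mulrA -Ezx -Eyz -Exy.
have Lyzx : L = y + z + x by rewrite /L -addrA addrC.
have Lzxy : L = z + x + y by rewrite /L addrC addrA.
have Pxy := associator_transition (erefl L) Lx Ly Lz solx soly Exy.
have Pyz := associator_transition Lyzx Ly Lz Lx soly solz Eyz.
have Pzx := associator_transition Lzxy Lz Lx Ly solz solx Ezx.
have wK := transition_comm (0 +i* (pi / 3)).
have wKyz := commr_sym (wK _ _ _ _ _ _ _ Ly Lz Lx soly solz Eyz).
have wKxy := commr_sym (wK _ _ _ _ _ _ _ Lx Ly Lz solx soly Exy).
rewrite Pxy Pyz Pzx.
move: theta theta' sum_thetas => t t' tt'.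
have ipiE : ipi = t - t' by rewrite tt'.
have cancel X : fps_exp (- t) X * fps_exp ipi X * fps_exp t' X = 1.
  by rewrite -!fps_expD ipiE addKr addNr fps_exp0.
have wE s' X : GRing.comm L X ->
    GRing.comm (fps_exp (0 +i* (pi / 3)) L) (fps_exp s' X).
  by move=> LX; exact: fps_exp_comm.
apply: (hexagon_regroup (wE _ _ Lz) (wE _ _ Lz) wKyz (wE _ _ Ly) (wE _ _ Ly)
  (wE _ _ Ly) wKxy (wE _ _ Lx) (cancel z) (cancel y) _ KKK).
- by rewrite -!fps_expD ipiE subrK subrr fps_exp0.
- rewrite -!fps_expD; congr (fps_exp _ L).
  by apply: complex_eqP; rewrite /ipi /=; field.
Qed.

End Hexagon.

Theorem theorem22 (R : realType) (A : algType R[i]) (a b c : A)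
  (hA : GRing.comm (a + b + c) a)
  (hB : GRing.comm (a + b + c) b)
  (hC : GRing.comm (a + b + c) c) :
  let ipi : R[i] := 0 +i* pi in
  fps_exp ipi (a + b + c) =
    fps_exp ipi a *_fps drinfeld_associator c a
      *_fps fps_exp ipi c *_fps drinfeld_associator b c
      *_fps fps_exp ipi b *_fps drinfeld_associator a b.
Proof.
have H := hexagon_equation hA hB hC.
by cbv zeta in H |- *; rewrite 5!fps_mulE; exact: H.
Qed.
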